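(* Let $d\ge2$ and let $\chi$ be a configuration. For every smooth nondegenerate curve $\gamma$ in $\mathbb{RP}^d$ with monodromy, with normalized lift $\Gamma$ and functions $u_0,\dots,u_{d-1}$, the $\varepsilon$-expansion $\Gamma_\varepsilon=\Gamma+\varepsilon G_1\Gamma+\varepsilon^2G_2\Gamma+O(\varepsilon^3)$ of the normalized lift $\Gamma_\varepsilon$ of $T_\varepsilon^\chi(\gamma)$ is given by $$G_1=\alpha_{1,1}\,\partial,\qquad G_2=\alpha_{2,2}\Big(\partial^2+\frac{2}{d+1}u_{d-1}\Big)-\frac{\alpha_{1,1}^2}{d+1}u_{d-1},$$ where the coefficients $\alpha_{1,1}$ and $\alpha_{2,2}$ are constant in $x$. In particular, if $\chi$ is centralized (i.e. $G_1=0$) and $G_2\ne0$, then the continuous limit of the $\chi$-pentagram map, defined by $\frac{d}{dt}\Gamma=G_2\Gamma$, corresponds to the $(2,d+1)$-KdV equation; that is, $G_2=cQ_2$ with $c$ a nonzero constant and $Q_2=\partial^2+\frac{2}{d+1}u_{d-1}$, so that the evolution of $L=\partial^{d+1}+u_{d-1}\partial^{d-1}+\dots+u_0$ determined by $L\Gamma=0$ is $\frac{d}{dt}L=c[Q_2,L]$, i.e. $\frac{d}{dt}L=[Q_2,L]$ after constant rescaling of time.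
   Context: Write $\partial=\frac{d}{dx}$. A curve $\gamma:\mathbb{R}\to\mathbb{RP}^d$ has monodromy $M\in\mathrm{PGL}(d+1,\mathbb{R})$ if $\gamma(x+2\pi)=M\cdot\gamma(x)$ for all $x$; it is nondegenerate if $\gamma'(x),\dots,\gamma^{(d)}(x)$ are linearly independent for every $x$ in some (hence any) affine chart. Its normalized lift is a smooth lift $\Gamma$ to $\mathbb{R}^{d+1}$ with $\det(\Gamma,\Gamma',\dots,\Gamma^{(d)})\equiv1$ (which exists, after composing $\gamma$ with a projective transformation if necessary); it satisfies $\Gamma^{(d+1)}+u_{d-1}\Gamma^{(d-1)}+\dots+u_0\Gamma=0$ with smooth $2\pi$-periodic $u_i$. A configuration is $\chi=\{\{p_{1,0},\dots,p_{1,q_1}\},\dots,\{p_{r,0},\dots,p_{r,q_r}\}\}$ with $p_{i,j}\in\mathbb{R}$, $p_{i,j}\neq p_{i,k}$ for $j\ne k$, integers $1\le q_i\le d$, and $(d-q_1)+\dots+(d-q_r)=d$. For $\varepsilon>0$ let $P_\varepsilon^i(x)$ be the projective subspace spanned by $\gamma(x+p_{i,0}\varepsilon),\dots,\gamma(x+p_{i,q_i}\varepsilon)$. The $\chi$-pentagram map sends $\gamma$ to the curve $T_\varepsilon^\chi(\gamma)(x)=\bigcap_{i=1}^rP_\varepsilon^i(x)$. Standing nondegeneracy assumption on $\chi$: let $e_0,\dots,e_d$ be the standard basis of $\mathbb{R}^{d+1}$ and $g(p)=\sum_{k=0}^d\frac{p^k}{k!}e_k$; the $d\times d$ matrix with rows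 indexed by pairs $(i,j)$, $1\le i\le r$, $1\le j\le d-q_i$, and columns by $\ell\in\{1,\dots,d\}$, whose entry is the coefficient of $e_0\wedge\dots\wedge e_{q_i}\wedge e_{q_i+j}$ in $e_\ell\wedge g(p_{i,0})\wedge\dots\wedge g(p_{i,q_i})$, is invertible. Then for small $\varepsilon$ the intersection is a single point depending smoothly on $x$, and its lift $\Gamma_\varepsilon$ normalized by $\det(\Gamma_\varepsilon,\Gamma_\varepsilon',\dots,\Gamma_\varepsilon^{(d)})\equiv1$ and $\Gamma_\varepsilon\to\Gamma$ has an expansion $\Gamma_\varepsilon=\Gamma+\varepsilon G_1\Gamma+\varepsilon^2G_2\Gamma+\dots$ with $G_i=\sum_{j=0}^d\alpha_{i,j}\partial^j$, $\alpha_{i,j}=\alpha_{i,j}(x)$ ($G_0=1$). KdV. For $L=\partial^{d+1}+u_{d-1}\partial^{d-1}+\dots+u_0$ let $L^{1/(d+1)}=\partial+\sum_{i<0}b_i\partial^i$ be its pseudodifferential $(d+1)$-th root and $Q_m=((L^{1/(d+1)})^m)_+$ the differential part; $Q_2=\partial^2+\frac{2}{d+1}u_{d-1}$. The $(m,d+1)$-KdV equation is $\frac{d}{dt}L=[Q_m,L]$. It is a known fact that, if $L\Gamma=0$, the evolution $\frac{d}{dt}\Gamma=Q_m\Gamma$ implies $\frac{d}{dt}L=[Q_m,L]$. *)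

(* Defs.v *)
From HB Require Import structures.
From mathcomp Require Export all_boot all_order all_algebra.
From mathcomp Require Export all_classical all_reals all_analysis.

Set Implicit Arguments.
Unset Strict Implicit.
Unset Printing Implicit Defensive.

Import Order.TTheory GRing.Theory Num.Theory.
Import numFieldNormedType.Exports.

Local Open Scope ring_scope.
Local Open Scope classical_set_scope.

Section Smoothness.
Context {R : realType} {V : normedModType R}.

Definition smooth (f : R -> V) : Prop :=
  forall n x, derivable (derive1n n f) x 1.

(* [f t x] is of class C^n in (t, x) on the open set [D] of the plane. *)
Fixpoint Cn_on (n : nat) (D : set (R * R)) (f : R -> R -> V) : Prop :=
  (forall p, D p -> {for p, continuous (fun q : R * R => f q.1 q.2)}) /\
  (if n is m.+1 then
     [/\ forall p, D p ->
           derivable (fun t => f t p.2) p.1 1 /\ derivable (f p.1) p.2 1,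
         Cn_on m D (fun t x => derive1 (f^~ x) t)
       & Cn_on m D (fun t x => derive1 (f t) x)]
   else True).

Definition smooth_on (D : set (R * R)) (f : R -> R -> V) : Prop :=
  forall n, Cn_on n D f.

End Smoothness.

(* RP^d is the set of lines of R^(d+1) (row vectors), and projective subspaces
   are linear subspaces of R^(d+1); span and intersection are the sum and the
   intersection of subspaces. *)

Record RP (R : realType) (d : nat) := MkRP {
  line :> {vspace 'rV[R]_d.+1};
  line_dim : \dim line = 1%N }.

Section Curves.
Context {R : realType} {d : nat}.

(* Affine chart [v] |-> (v_j / v_k)_(j != k), defined where v_k != 0. *)
Definition in_chart (k : 'I_d.+1) (l : RP R d) : bool := vpick l 0 k != 0.
Definition chart (k : 'I_d.+1) (l : RP R d) : 'rV[R]_d :=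
  col' k ((vpick l 0 k)^-1 *: vpick l).

Definition smooth_curve (gamma : R -> RP R d) : Prop :=
  forall x : R, exists k : 'I_d.+1, \forall y \near x,
    in_chart k (gamma y) /\
    forall n, derivable (derive1n n (chart k \o gamma)) y 1.

Definition nondegenerate (gamma : R -> RP R d) : Prop :=
  forall x : R, exists k : 'I_d.+1, in_chart k (gamma x) /\
    row_free (\matrix_(i < d) derive1n i.+1 (chart k \o gamma) x).

Definition has_monodromy (gamma : R -> RP R d) (M : 'M[R]_d.+1) : Prop :=
  forall x, line (gamma (x + 2 * pi)) = (linfun (mulmxr M) @: gamma x)%VS.

Definition wronskian (Gamma : R -> 'rV[R]_d.+1) (x : R) : R :=
  \det (\matrix_(i < d.+1) derive1n i Gamma x).

Definition normalized_lift (gamma : R -> RP R d) (Gamma : R -> 'rV[R]_d.+1) :=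
  [/\ smooth Gamma,
      forall x, line (gamma x) = <[Gamma x]>%VS
    & forall x, wronskian Gamma x = 1].

End Curves.

Record config (R : realType) (d : nat) := Config {
  cr : nat;
  cq : 'I_cr -> nat;
  cp : forall i : 'I_cr, 'I_(cq i).+1 -> R;
  cp_inj : forall i, injective (@cp i);
  cq_bounds : forall i, (1 <= cq i <= d)%N;
  cq_sum : (\sum_(i < cr) (d - cq i))%N = d }.

Arguments cp {R d} c i _.

Section Pentagram.
Context {R : realType} {d : nat}.
Implicit Types (chi : config R d).

Definition span_at chi (gamma : R -> RP R d) (eps : R) (i : 'I_(cr chi)) (x : R)
    : {vspace 'rV[R]_d.+1} :=
  (\sum_(j < (cq i).+1) gamma (x + cp chi i j * eps)%R)%VS.

(* As a linear subspace; it is a point of RP^d exactly when it is a line. *)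
Definition pentagram chi (eps : R) (gamma : R -> RP R d) (x : R)
    : {vspace 'rV[R]_d.+1} :=
  (\bigcap_(i < cr chi) span_at gamma eps i x)%VS.

Definition gvec (p : R) : 'rV[R]_d.+1 := \row_(k < d.+1) (p ^+ k / k`!%:R).

(* The columns 0, ..., q, q + j + 1 (all at most d when q + j < d). *)
Definition wedge_cols (q j : nat) (b : 'I_(1 + q.+1)) : 'I_d.+1 :=
  inord (if (b <= q)%N then b : nat else (q + j.+1)%N).

(* The coefficient of e_(f 0) /\ ... /\ e_(f m) in the wedge product of the rows
   of a matrix is the minor on the columns f 0 < ... < f m. The indices [l] and
   [j] are 0-based, hence stand for l + 1 and j + 1 in the usual notation. *)
Definition nondeg_block chi (i : 'I_(cr chi)) : 'M[R]_(d - cq i, d) :=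
  \matrix_(j, l)
    \det (colsub (wedge_cols (q := cq i) j)
           (col_mx (delta_mx 0 (lift ord0 l))
                   (\matrix_(a < (cq i).+1) gvec (cp chi i a)))).

Definition nondegenerate_config chi : Prop :=
  castmx (cq_sum chi, erefl d) (\mxcol_(i < cr chi) nondeg_block i) \in unitmx.

(* [Geps eps] is the lift Gamma_eps, defined for all small eps > 0. *)
Definition pentagram_lift chi (gamma : R -> RP R d) (Gamma : R -> 'rV[R]_d.+1)
    (Geps : R -> R -> 'rV[R]_d.+1) : Prop :=
  (exists2 eps0 : R, 0 < eps0 & forall eps : R, 0 < eps < eps0 ->
     [/\ smooth (Geps eps),
         forall x, pentagram chi eps gamma x = <[Geps eps x]>%VS
       & forall x, wronskian (Geps eps) x = 1]) /\
  (forall x, Geps eps x @[eps --> 0^'+] --> Gamma x).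

End Pentagram.

(* A differential operator sum_j a_j(x) D^j, D = d/dx, is encoded by its symbol
   sum_j a_j 'X^j, a polynomial over the ring of functions R -> R. Only the
   additive structure of {poly (R -> R)} corresponds to that of operators:
   composition is not the product of polynomials. *)

Notation diffop R := {poly (R -> R)}.

Section DiffOp.
Context {R : realType}.

Definition dact {V : normedModType R} (A : diffop R) (f : R -> V) (x : R) : V :=
  \sum_(j < size A) (A`_j : R -> R) x *: derive1n j f x.

Variable d : nat.

(* L = D^(d+1) + u_(d-1) D^(d-1) + ... + u_0; u_i is used for i < d only. *)
Definition Lop (u : nat -> R -> R) : diffop R :=
  'X^(d.+1) + \sum_(i < d) u i *: 'X^i.

Definition Q2op (u : nat -> R -> R) : diffop R :=
  'X^2 + (fun x => 2 / d.+1%:R * u d.-1 x)%:P.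

Definition curve_equation (u : nat -> R -> R) (Gamma : R -> 'rV[R]_d.+1) :=
  [/\ forall i, (i < d)%N -> smooth (u i),
      forall i, (i < d)%N -> forall x, u i (x + 2 * pi) = u i x
    & forall x, dact (Lop u) Gamma x = 0].

(* Gamma_eps = Gamma + eps G1 Gamma + eps^2 G2 Gamma + O(eps^3), locally
   uniformly in x, with G1 and G2 of order at most d. *)
Definition expansion (Gamma : R -> 'rV[R]_d.+1) (Geps : R -> R -> 'rV[R]_d.+1)
    (G1 G2 : diffop R) : Prop :=
  [/\ (size G1 <= d.+1)%N, (size G2 <= d.+1)%N &
   forall a b : R, exists C delta : R, 0 < delta /\
     forall eps x : R, 0 < eps < delta -> a <= x <= b ->
       `| Geps eps x -
          (Gamma x + eps *: dact G1 Gamma x + eps ^+ 2 *: dact G2 Gamma x) |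
       <= C * eps ^+ 3].

Record pentagram_setting (chi : config R d) (gamma : R -> RP R d)
    (Gamma : R -> 'rV[R]_d.+1) (u : nat -> R -> R)
    (Geps : R -> R -> 'rV[R]_d.+1) : Prop := PentagramSetting {
  ps_smooth : smooth_curve gamma;
  ps_nondeg : nondegenerate gamma;
  ps_monodromy : exists2 M, M \in unitmx & has_monodromy gamma M;
  ps_lift : normalized_lift gamma Gamma;
  ps_eq : curve_equation u Gamma;
  ps_image : pentagram_lift chi gamma Gamma Geps }.

Definition centralized (chi : config R d) : Prop :=
  forall gamma Gamma u Geps G1 G2,
    pentagram_setting chi gamma Gamma u Geps ->
    expansion Gamma Geps G1 G2 -> G1 = 0.

(* A solution, for t in the interval ]t0, t1[, of the continuous limit
   d/dt Gamma = G2 Gamma, where G2 <> 0 is recomputed from Gamma at each t. *)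
Definition continuous_limit (chi : config R d) (t0 t1 : R)
    (Gamma : R -> R -> 'rV[R]_d.+1) (u : R -> nat -> R -> R) : Prop :=
  smooth_on [set p | t0 < p.1 < t1] Gamma /\
  forall t, t0 < t < t1 -> exists gamma Geps G1 G2,
    [/\ pentagram_setting chi gamma (Gamma t) (u t) Geps,
        expansion (Gamma t) Geps G1 G2,
        G2 != 0 &
        forall x, is_derive t 1 (fun s => Gamma s x) (dact G2 (Gamma t) x)].

(* d/dt L = c [Q, L], as an identity of operators on smooth functions. *)
Definition lax_equation (c : R) (T : set R) (u : R -> nat -> R -> R)
    (Q : R -> diffop R) : Prop :=
  forall t, T t ->
    (forall (i : nat) (x : R), (i < d)%N -> derivable (fun s : R => u s i x) t 1) /\
    forall (f : R -> R) x, smooth f ->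
      \sum_(i < d) derive1 (fun s => u s i x) t * derive1n i f x =
      c * (dact (Q t) (dact (Lop (u t)) f) x -
           dact (Lop (u t)) (dact (Q t) f) x).

End DiffOp.

Section PseudoDiff.
Context {R : realType}.

(* The formal series sum_(k >= 0) (pcoef k) D^(pord - k). *)
Record psido := PsiDO { pord : int; pcoef : nat -> R -> R }.

Definition binz (z : int) (l : nat) : R :=
  (\prod_(s < l) (z - s%:Z)%:~R) / l`!%:R.

(* Composition: D^n b = sum_(l >= 0) binz n l b^(l) D^(n - l). *)
Definition psi_mul (A B : psido) : psido :=
  PsiDO (pord A + pord B) (fun k x =>
    \sum_(i < k.+1) \sum_(j < k.+1 | (i + j <= k)%N)
      binz (pord A - i%:Z) (k - (i + j)) *
      pcoef A i x * derive1n (k - (i + j)) (pcoef B j) x).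

Definition psi_exp (A : psido) (n : nat) : psido :=
  iter n (psi_mul A) (PsiDO 0 (fun k => cst (k == 0)%:R)).

Definition psi_plus (A : psido) : diffop R :=
  if pord A is Posz n then \poly_(k < n.+1) pcoef A (n - k) else 0.

Definition psi_of (A : diffop R) : psido :=
  let n := (size A).-1 in
  PsiDO n (fun k => if (k <= n)%N then A`_(n - k) else cst 0).

(* K = D + sum_(i < 0) b_i D^i with smooth b_i, and K^n = L. *)
Definition psi_root (n : nat) (L : diffop R) (K : psido) : Prop :=
  [/\ pord K = 1, pcoef K 0 = cst 1 /\ pcoef K 1 = cst 0,
      forall k, smooth (pcoef K k)
    & psi_exp K n = psi_of L].

Definition kdvQ (m : nat) (K : psido) : diffop R := psi_plus (psi_exp K m).

End PseudoDiff.

(* Main.v *)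
(* In the moving frame Gamma(x), Gamma'(x), ..., Gamma^(d)(x), the coordinates of
   Gamma(x + p eps), rescaled by eps^-k in the direction Gamma^(k), are
   p^k / k! + O(eps^2): the error is not only O(eps) because L has no term of order
   d. The subspaces P^i therefore cut out, by Cramer's rule, a point whose rescaled
   coordinates agree up to O(eps^2) with constants that depend on chi alone, and
   these constants are alpha_11 and alpha_22. Normalizing the lift is then a
   computation of its Wronskian up to O(eps^3), in which only the companion matrix
   of L enters. For the Lax equation, Q L - L Q turns out to have order at most d,
   so it is determined by its values on the d + 1 components of Gamma, where it is
   found by differentiating L Gamma = 0 in t. *)

Require Import Defs.
From mathcomp Require Import fingroup perm ring lra zify.

Import Order.TTheory GRing.Theory Num.Theory.
Import numFieldNormedType.Exports.

Set Implicit Arguments.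
Unset Strict Implicit.
Unset Printing Implicit Defensive.

Local Open Scope ring_scope.
Local Open Scope classical_set_scope.

(** * Smooth functions of one variable *)

(** The lift [Geps] is not constructed: for small eps it is only known to be smooth in x, to span
    the intersection and to have Wronskian 1, and it tends to Gamma pointwise. Cramer's rule makes
    it a scalar lambda times a curve V = (1 + eps^2 h) Gamma + eps alpha_11 Gamma' + eps^2 alpha_22
    Gamma'' + O(eps^3), and the question is the size of lambda. As a Wronskian involves
    x-derivatives, the errors in V must be small together with all their x-derivatives; hence
    [smoothO] beside [bigO]. The Wronskian of V is 1 + eps^2 ((d+1) h + (alpha_11^2 - 2 alpha_22)
    u_(d-1)) + O(eps^3), and lambda^(d+1) times it is 1. So lambda = 1 - eps^2 (h + (alpha_11^2 - 2
    alpha_22) u_(d-1) / (d+1)) + O(eps^3): the uncontrolled h cancels in lambda V, and what is left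
    is the potential of the statement. The equation fixes lambda only up to sign when d + 1 is even;
    this is where the convergence to Gamma enters. *)

Section PointwiseClosure.
Context {R : comNzRingType} {T : Type} (P : (T -> R) -> Prop).
Hypothesis P_cst : forall c, P (fun=> c).
Hypothesis P_add : forall f g, P f -> P g -> P (fun t => f t + g t).
Hypothesis P_mul : forall f g, P f -> P g -> P (fun t => f t * g t).

Lemma closed_sum (I : Type) (r : seq I) (Q : pred I) (F : I -> T -> R) :
  (forall i, Q i -> P (F i)) -> P (fun t => \sum_(i <- r | Q i) F i t).
Proof.
move=> PF; elim: r => [|i r IH].
  by under eq_fun do rewrite big_nil; exact: P_cst.
under eq_fun do rewrite big_cons; case Qi: (Q i) => //.
by apply: (P_add (PF _ Qi)).
Qed.

Lemma closed_prod (I : Type) (r : seq I) (Q : pred I) (F : I -> T -> R) :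
  (forall i, Q i -> P (F i)) -> P (fun t => \prod_(i <- r | Q i) F i t).
Proof.
move=> PF; elim: r => [|i r IH].
  by under eq_fun do rewrite big_nil; exact: P_cst.
under eq_fun do rewrite big_cons; case Qi: (Q i) => //.
by apply: (P_mul (PF _ Qi)).
Qed.

(** Determinants and cofactors are polynomials in the entries, so they inherit any property closed
    under sums and products. [P] will be smoothness in x, closeness to a constant up to O(eps^2),
    and derivability in time. *)
Lemma closed_det n (M : T -> 'M[R]_n) :
  (forall i j, P (fun t => M t i j)) -> P (fun t => \det (M t)).
Proof.
move=> PM; apply: closed_sum => s _; apply: (P_mul (P_cst _)).
by apply: closed_prod => i _; exact: PM.
Qed.

Lemma closed_adj n (M : T -> 'M[R]_n) :
  (forall i j, P (fun t => M t i j)) -> forall i j, P (fun t => \adj (M t) i j).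
Proof.
move=> PM i j; under eq_fun do rewrite mxE /cofactor.
apply: (P_mul (P_cst _)).
by apply: closed_det => k l; under eq_fun do rewrite !mxE; exact: PM.
Qed.

End PointwiseClosure.

Section Smooth.
Context {R : realType}.
Implicit Types (f g : R -> R) (x y : R).

Lemma smooth_derivable f x : smooth f -> derivable f x 1.
Proof. by move=> /(_ 0%N x). Qed.

Lemma smooth_is_derive f x : smooth f -> is_derive x (1 : R) f (f^`() x).
Proof. by move=> sf; rewrite derive1E; apply/derivableP/smooth_derivable. Qed.

Lemma smooth_derive1n n f : smooth f -> smooth (derive1n n f).
Proof.
by move=> sf m x; rewrite /derive1n -iterD; exact: (sf (m + n)%N x).
Qed.

Lemma smooth_derive1 f : smooth f -> smooth f^`().
Proof. exact: (@smooth_derive1n 1). Qed.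

Lemma derive1_val f (x df : R) : is_derive x 1 f df -> f^`() x = df.
Proof. by rewrite derive1E => h; exact: derive_val. Qed.

Lemma smooth_cst (c : R) : smooth (fun=> c : R).
Proof.
move=> n x; suff [k ->] : exists k, derive1n n (fun=> c : R) = cst k.
  exact: derivable_cst.
elim: n => [|n [k IH]]; first by exists c.
by exists 0; rewrite derive1nS IH; apply/funext => y; rewrite derive1_cst.
Qed.

Lemma derive1n_cst n (c : R) : derive1n n.+1 (fun=> c : R) = fun=> 0.
Proof.
elim: n => [|n IH]; first by apply/funext => y; rewrite derive1n1 (derive1_cst c).
by rewrite derive1nS IH; apply/funext => y; rewrite (derive1_cst 0).
Qed.

Lemma derive1nD n f g : smooth f -> smooth g ->
  derive1n n (fun x => f x + g x) = fun x => derive1n n f x + derive1n n g x.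
Proof.
move=> sf sg; elim: n => [//|n IH]; rewrite derive1nS IH; apply/funext => x.
apply: derive1_val; rewrite !derive1nS.
by apply: is_deriveD; apply: smooth_is_derive; apply: smooth_derive1n.
Qed.

Lemma smoothD f g : smooth f -> smooth g -> smooth (fun x => f x + g x).
Proof.
move=> sf sg n x; rewrite derive1nD //.
exact: (derivableD (sf n x) (sg n x)).
Qed.

Lemma derive1nZ n (c : R) f : smooth f ->
  derive1n n (fun x => c * f x) = fun x => c * derive1n n f x.
Proof.
move=> sf; elim: n => [//|n IH]; rewrite derive1nS IH; apply/funext => x.
apply: derive1_val; rewrite derive1nS.
by apply: is_deriveZ; apply: smooth_is_derive; apply: smooth_derive1n.
Qed.

Lemma smooth_sum (I : Type) (r : seq I) (F : I -> R -> R) :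
  (forall i, smooth (F i)) -> smooth (fun x => \sum_(i <- r) F i x).
Proof.
move=> sF; apply: (@closed_sum R R smooth) => [c|f g sf sg|i _].
- exact: smooth_cst.
- exact: (smoothD sf sg).
- exact: sF.
Qed.

Lemma derive1n_sum n (I : Type) (r : seq I) (F : I -> R -> R) :
  (forall i, smooth (F i)) ->
  derive1n n (fun x => \sum_(i <- r) F i x) =
  fun x => \sum_(i <- r) derive1n n (F i) x.
Proof.
move=> sF; elim: r => [|i r IH].
  under eq_fun do rewrite big_nil; under [RHS]eq_fun do rewrite big_nil.
  by case: n => // n; rewrite derive1n_cst.
under eq_fun do rewrite big_cons; under [RHS]eq_fun do rewrite big_cons.
by rewrite (derive1nD n (sF i) (@smooth_sum _ r _ sF)) IH.
Qed.

Theorem derive1nM n f g : smooth f -> smooth g ->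
  derive1n n (fun x => f x * g x) =
  fun x => \sum_(i < n.+1) 'C(n, i)%:R * (derive1n (n - i) f x * derive1n i g x).
Proof.
move=> sf sg; elim: n => [|n IH].
  by apply/funext => x; rewrite big_ord_recl big_ord0 bin0 mul1r addr0.
rewrite derive1nS IH; apply/funext => x.
transitivity (\sum_(i < n.+1) 'C(n, i)%:R *
   (derive1n (n - i) f x * derive1n i.+1 g x +
    derive1n i g x * derive1n (n - i).+1 f x)).
  apply: derive1_val; rewrite (_ : (fun _ => _) = \sum_(i < n.+1) (fun x :
    R => 'C(n, i)%:R *
     (derive1n (n - i) f x * derive1n i g x))); last first.
    by apply/funext => y; rewrite fct_sumE.
  apply: is_derive_sum => i; apply: is_deriveZ; rewrite !derive1nS.
  by apply: is_deriveM; apply: smooth_is_derive; apply: smooth_derive1n.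
under eq_bigr do rewrite mulrDr.
rewrite big_split /= addrC.
rewrite big_ord_recl [in RHS]big_ord_recl /= !subn0 !bin0 -addrA.
congr (_ + _); first by rewrite [X in _ * X]mulrC.
rewrite [X in _ + X]big_ord_recr /= [in RHS]big_ord_recr /= !binn !subnn addrA.
congr (_ + _); rewrite -big_split /=; apply: eq_bigr => i _.
rewrite /bump /= !add1n binS natrD mulrDl subSS; congr (_ + _).
have ->: (n - i)%N = (n - i.+1).+1 by rewrite -subSn ?ltn_ord // subSS.
by congr (_ * _); exact: mulrC.
Qed.

Lemma smoothM f g : smooth f -> smooth g -> smooth (fun x => f x * g x).
Proof.
move=> sf sg n x; rewrite derive1nM //.
rewrite (_ : (fun _ => _) = \sum_(i < n.+1) (fun x : R => 'C(n, i)%:R *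
     (derive1n (n - i) f x * derive1n i g x))); last first.
  by apply/funext => y; rewrite fct_sumE.
apply: derivable_sum => i; apply: derivableZ.
exact: (derivableM (sf (n - i)%N x) (sg i x)).
Qed.

Lemma smoothZ (c : R) f : smooth f -> smooth (fun x => c * f x).
Proof. by move=> sf; exact: (smoothM (@smooth_cst c) sf). Qed.

Lemma smoothN f : smooth f -> smooth (fun x => - f x).
Proof.
by move=> sf; under eq_fun do rewrite -mulN1r; exact: (@smoothZ (-1) _ sf).
Qed.

Lemma smooth_continuous f : smooth f -> continuous f.
Proof.
move=> sf x; apply: differentiable_continuous.
by apply/derivable1_diffP; exact: smooth_derivable.
Qed.

Lemma smooth_shift f (s : R) : smooth f ->
  smooth (fun x => f (x + s)) /\
  forall n, derive1n n (fun x => f (x + s)) = fun x => derive1n n f (x + s).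
Proof.
move=> sf.
have sh x g : smooth g -> is_derive x 1 (fun x => g (x + s)) (g^`() (x + s)).
  move=> sg; rewrite -[g^`() _]mulr1.
  exact: (@realfun.is_derive1_comp _ g (shift s) x _ _
    (smooth_is_derive _ sg) (is_derive_shift x 1 s)).
have E n : derive1n n (fun x => f (x + s)) = fun x => derive1n n f (x + s).
  elim: n => [//|n IH]; rewrite derive1nS IH; apply/funext => x.
  by apply: derive1_val; rewrite derive1nS; apply: sh; exact: smooth_derive1n.
split; last exact: E.
move=> n x; rewrite E.
by have [] := sh x _ (@smooth_derive1n n _ sf).
Qed.

(** [s] may be negative because it will be p eps with p of any sign. The bound |t| <= |s| is all
    that an induction on Taylor remainders needs. *)
Lemma is_derive_mvt f (df : R -> R) (a s : R) :
  (forall x, is_derive x 1 f (df x)) ->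
  exists2 t, `|t| <= `|s| & f (a + s) - f a = df (a + t) * s.
Proof.
move=> fd.
have cf : continuous f.
  move=> x; apply: differentiable_continuous; apply/derivable1_diffP.
  exact: ex_derive.
have [s0|s0] := leP 0 s.
  have [||c] := @MVT_segment R f df a (a + s).
  - by rewrite lerDl.
  - by apply: continuous_subspaceT.
  rewrite in_itv /= => /andP[c1 c2] E; exists (c - a).
    by rewrite !ger0_norm ?subr_ge0 // lerBlDl.
  by rewrite E [a + s - a]addrAC subrr add0r [a + _]addrC subrK.
have [||c] := @MVT_segment R f df (a + s) a.
- by rewrite gerDl ltW.
- by apply: continuous_subspaceT.
rewrite in_itv /= => /andP[c1 c2] E; exists (c - a).
  by rewrite !ler0_norm ?subr_le0 ?(ltW s0) //; lra.
rewrite -opprB E [a + (c - a)]addrC subrK -mulrN; congr (_ * _); ring.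
Qed.

Definition taylor N f (x s : R) :=
  \sum_(j < N) s ^+ j / j`!%:R * derive1n j f x.

Lemma is_derive_taylor N f (x s : R) :
  is_derive s 1 (taylor N.+1 f x) (taylor N f^`() x s).
Proof.
rewrite (_ : taylor N.+1 f x = \sum_(j < N.+1) (fun s =>
  (derive1n j f x / j`!%:R) * s ^+ j)); last first.
  by apply/funext => t; rewrite fct_sumE; apply: eq_bigr => j _; ring.
have -> : taylor N f^`() x s =
    \sum_(j < N.+1) (derive1n j f x / j`!%:R) * (j%:R * s ^+ j.-1).
  rewrite big_ord_recl mul0r mulr0 add0r /taylor; apply: eq_bigr => i _.
  rewrite lift0 derive1Sn factS natrM; field.
  by rewrite nat1r !pnatr_eq0 -!lt0n fact_gt0.
apply: is_derive_sum => j; apply: is_deriveZ.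
apply: DeriveDef; first exact: exprn_derivable.
by rewrite exp_derive /GRing.scale /= mulr1.
Qed.

(** Induction on the order: the derivative in [s] of the remainder of order N + 1 of f is the
    remainder of order N of f', so the mean value theorem yields one more factor |s|. The factor
    1/N! is given up. *)
Lemma taylor_bound N f (K x s : R) : smooth f ->
  (forall y, `|y - x| <= `|s| -> `|derive1n N f y| <= K) ->
  `|f (x + s) - taylor N f x s| <= K * `|s| ^+ N.
Proof.
elim: N f s => [|N IH] f s sf fK.
  by rewrite /taylor big_ord0 subr0 expr0 mulr1; apply: fK;
    rewrite addrAC subrr add0r.
have [|t ts] := @is_derive_mvt (fun s => f (x + s) - taylor N.+1 f x s)
  (fun s => derive1 f (x + s) - taylor N (derive1 f) x s) 0 s.
  move=> y; apply: is_deriveB; last exact: is_derive_taylor.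
  have [sh E] := smooth_shift x sf.
  have := @smooth_is_derive _ y sh; rewrite -derive1n1 E addrC.
  by under eq_fun do rewrite addrC.
rewrite !add0r addr0 [in X in _ - X](_ : taylor _ _ _ 0 = f x); last first.
  rewrite /taylor big_ord_recl big1 ?addr0 /= ?expr0 ?fact0 ?divr1 ?mul1r //.
  by move=> i _; rewrite expr0n mul0r mul0r.
rewrite subrr subr0 => ->; rewrite normrM.
have Kt : `|derive1 f (x + t) - taylor N (derive1 f) x t| <= K * `|t| ^+ N.
  apply: IH; first exact: smooth_derive1.
  by move=> y yt; rewrite -derive1Sn; apply: fK; apply: le_trans ts.
have K0 : 0 <= K by apply: le_trans (fK x _); rewrite ?normr_ge0 ?subrr ?normr0.
apply: le_trans (_ : K * `|t| ^+ N * `|s| <= _); first by rewrite ler_wpM2r.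
rewrite exprSr mulrA ler_wpM2r // ler_wpM2l //.
by rewrite lerXn2r ?nnegrE.
Qed.

Lemma continuous_bounded f (a b : R) : continuous f ->
  exists K, forall x, a <= x <= b -> `|f x| <= K.
Proof.
move=> cf; have [ab|ab] := leP a b; last first.
  by exists 0 => x /andP[ax xb]; move: (le_trans ax xb); rewrite leNgt ab.
have [|c _ M] := @EVT_max R (fun x => `|f x|) a b ab.
  apply: continuous_subspaceT => x; apply: cvg_norm; exact: cf.
by exists `|f c| => x xab; apply: M; rewrite in_itv.
Qed.

End Smooth.

(** * Families of size eps^k, locally uniformly in x *)

Section BigO.
Context {R : realType}.
Implicit Types (f g : R -> R -> R) (P Q : R -> R -> Prop) (k m : nat).

Definition evloc P := forall a b : R,
  \forall e \near 0^'+, forall x, a <= x <= b -> P e x.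

(** Local uniformity in x is that of [expansion]: the constant and the range of eps may depend on
    the interval. *)
Definition bigO k f := forall a b : R, exists C,
  \forall e \near 0^'+, forall x, a <= x <= b -> `|f e x| <= C * e ^+ k.

Lemma evloc_and P Q : evloc P -> evloc Q -> evloc (fun e x => P e x /\ Q e x).
Proof.
move=> hP hQ a b; move: (hP a b) (hQ a b); apply: filterS2 => e h1 h2 x xab.
by split; [exact: h1|exact: h2].
Qed.

Lemma evloc_mono P Q : (forall e x, P e x -> Q e x) -> evloc P -> evloc Q.
Proof.
by move=> PQ hP a b; move: (hP a b); apply: filterS => e h x xab; exact/PQ/h.
Qed.

Lemma evloc_gt0 : evloc (fun e _ => 0 < e).
Proof.
by move=> a b; near=> e => x _; near: e; exact: nbhs_right_gt.
Unshelve. all: by end_near. Qed.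

Lemma evloc_lt (r : R) : 0 < r -> evloc (fun e _ => e < r).
Proof.
by move=> r0 a b; near=> e => x _; near: e; exact: nbhs_right_lt.
Unshelve. all: by end_near. Qed.

Lemma bigO_ex k f : bigO k f -> forall a b : R, exists2 C, 0 <= C &
  \forall e \near 0^'+, forall x, a <= x <= b -> `|f e x| <= C * e ^+ k.
Proof.
move=> hf a b; have [C hC] := hf a b; exists `|C| => //.
move: hC (evloc_gt0 a b); apply: filterS2 => e h1 h2 x xab.
apply: le_trans (h1 x xab) _; apply: ler_wpM2r (ler_norm _).
by rewrite exprn_ge0 // ltW // (h2 x xab).
Qed.

Lemma bigO_bound k f g : evloc (fun e x => `|f e x| <= `|g e x|) ->
  bigO k g -> bigO k f.
Proof.
move=> h hg a b; have [C hC] := hg a b; exists C.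
move: hC (h a b); apply: filterS2 => e h1 h2 x xab.
exact: le_trans (h2 x xab) (h1 x xab).
Qed.

Lemma bigO_eq k f g : evloc (fun e x => f e x = g e x) -> bigO k g -> bigO k f.
Proof. by move=> h; apply: bigO_bound; apply: evloc_mono h => e x ->. Qed.

Lemma bigOD k f g : bigO k f -> bigO k g -> bigO k (fun e x => f e x + g e x).
Proof.
move=> hf hg a b; have [C hC] := hf a b; have [D hD] := hg a b.
exists (C + D); move: hC hD; apply: filterS2 => e h1 h2 x xab.
apply: le_trans (ler_normD _ _) _; rewrite mulrDl.
by apply: lerD; [exact: h1|exact: h2].
Qed.

Lemma bigOM k m f g : bigO k f -> bigO m g ->
  bigO (k + m) (fun e x => f e x * g e x).
Proof.
move=> /bigO_ex hf /bigO_ex hg a b; have [C C0 hC] := hf a b.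
have [D D0 hD] := hg a b.
exists (C * D); move: hC hD; apply: filterS2 => e h1 h2 x xab.
by rewrite normrM exprD mulrACA; apply: ler_pM; rewrite ?h1 ?h2.
Qed.

Lemma bigO_le k m f : (m <= k)%N -> bigO k f -> bigO m f.
Proof.
move=> mk /bigO_ex hf a b; have [C C0 hC] := hf a b; exists C.
near=> e => x xab; apply: le_trans (_ : C * e ^+ k <= _).
  by move: x xab; near: e.
rewrite ler_wpM2l //.
have e0 : 0 < e by near: e; exact: nbhs_right_gt.
have e1 : e < 1 by near: e; exact: nbhs_right_lt.
by rewrite ler_wiXn2l // ltW.
Unshelve. all: by end_near. Qed.

Lemma bigO_continuous (h : R -> R) : continuous h -> bigO 0 (fun _ x => h x).
Proof.
move=> ch a b; have [K hK] := continuous_bounded a b ch; exists K.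
by near=> e => x xab; rewrite expr0 mulr1; exact: hK.
Unshelve. all: by end_near. Qed.

Lemma bigO_cst (c : R) : bigO 0 (fun _ _ => c).
Proof. by apply: bigO_continuous; exact: cst_continuous. Qed.

Lemma bigO_exp k : bigO k (fun e _ => e ^+ k).
Proof.
move=> a b; exists 1; near=> e => x _.
have e0 : 0 < e by near: e; exact: nbhs_right_gt.
by rewrite mul1r ger0_norm // exprn_ge0 // ltW.
Unshelve. all: by end_near. Qed.

Lemma bigO_expM k m f : bigO m f -> bigO (k + m) (fun e x => e ^+ k * f e x).
Proof. exact: (bigOM (@bigO_exp k)). Qed.

Lemma bigOZ k (c : R) f : bigO k f -> bigO k (fun e x => c * f e x).
Proof. exact: (bigOM (@bigO_cst c)). Qed.

Lemma bigOMl k f g : bigO 0 f -> bigO k g -> bigO k (fun e x => f e x * g e x).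
Proof. exact: bigOM. Qed.

Lemma bigOMr k f g : bigO k f -> bigO 0 g -> bigO k (fun e x => f e x * g e x).
Proof. by move=> hf hg; rewrite -[k]addn0; exact: bigOM. Qed.

Lemma bigON k f : bigO k f -> bigO k (fun e x => - f e x).
Proof. by move=> hf a b; have [C hC] := hf a b; exists C;
  under eq_near do under eq_forall do rewrite normrN. Qed.

Lemma bigOB k f g : bigO k f -> bigO k g -> bigO k (fun e x => f e x - g e x).
Proof. by move=> hf hg; exact: bigOD hf (bigON hg). Qed.

Lemma bigO_0 k : bigO k (fun _ _ => 0).
Proof. by move=> a b; exists 0; near=> e => x _; rewrite normr0 mul0r.
Unshelve. all: by end_near. Qed.

Lemma bigO_sum k (I : Type) (r : seq I) (Q : pred I) (F : I -> R -> R -> R) :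
  (forall i, Q i -> bigO k (F i)) ->
  bigO k (fun e x => \sum_(i <- r | Q i) F i e x).
Proof.
move=> hF; elim: r => [|i r IH].
  by apply: bigO_eq (bigO_0 k) => a b; near=> e => x _; rewrite big_nil.
under eq_fun do under eq_fun do rewrite big_cons.
case Qi: (Q i) => //; exact: bigOD (hF i Qi) IH.
Unshelve. all: by end_near. Qed.

Lemma bigO_prod (I : Type) (r : seq I) (Q : pred I) (F : I -> R -> R -> R) :
  (forall i, Q i -> bigO 0 (F i)) ->
  bigO 0 (fun e x => \prod_(i <- r | Q i) F i e x).
Proof.
move=> hF; elim: r => [|i r IH].
  by apply: bigO_eq (bigO_cst 1) => a b; near=> e => x _; rewrite big_nil.
under eq_fun do under eq_fun do rewrite big_cons.
case Qi: (Q i) => //; exact: bigOMl (hF i Qi) IH.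
Unshelve. all: by end_near. Qed.

Lemma bigO_small k f (r : R) : 0 < r -> bigO k.+1 f ->
  evloc (fun e x => `|f e x| < r).
Proof.
move=> r0 /(bigO_le (ltn0Sn k))/bigO_ex hf a b; have [C C0 hC] := hf a b.
near=> e => x xab; apply: le_lt_trans (_ : C * e ^+ 1 < r).
  by move: x xab; near: e.
have e0 : 0 < e by near: e; exact: nbhs_right_gt.
have : e < r / (C + 1) by near: e; apply: nbhs_right_lt;
  rewrite divr_gt0 // ltr_wpDl.
rewrite ltr_pdivlMr ?ltr_wpDl //; apply: le_lt_trans.
by rewrite expr1 mulrDr mulr1 mulrC lerDl ltW.
Unshelve. all: by end_near. Qed.

(** For small eps the denominator is at least 1/2 in absolute value, whence the factor 2. *)
Lemma bigO_div k f g : bigO k f -> bigO 1 g ->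
  bigO k (fun e x => f e x / (1 + g e x)).
Proof.
move=> hf hg; apply: bigO_bound (bigOZ 2 hf).
have g2 := @bigO_small 0 g 2^-1 _ hg.
apply: evloc_mono (g2 _) => [e x h|]; last by rewrite invr_gt0.
have h1 : 2^-1 <= `|1 + g e x|.
  have := lerB_normD 1 (g e x); rewrite normr1; apply: le_trans; lra.
have h2 : 0 < `|1 + g e x| by apply: lt_le_trans h1; rewrite invr_gt0.
rewrite normrM normfV ler_pdivrMr // normrM (ger0_norm (ler0n _ 2)).
by have := normr_ge0 (f e x); nra.
Qed.

(** [bigO] is not stable under differentiation in x, and Wronskians differentiate up to d times, so
    the bound is imposed on all x-derivatives. Smoothness is asked for eps <= 0 too; there, dividing
    by eps^k is still multiplication by a constant in x. *)
Definition smoothO k f :=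
  (forall e, smooth (f e)) /\ forall n, bigO k (fun e => derive1n n (f e)).

Lemma smoothO_bigO k f : smoothO k f -> bigO k f.
Proof. by case=> _ /(_ 0%N). Qed.

Lemma smoothO_eq k f g : (forall e x, f e x = g e x) -> smoothO k f -> smoothO k g.
Proof. by move=> h; suff -> : f = g by []; apply/funext => e; apply/funext. Qed.

Lemma smoothOD k f g : smoothO k f -> smoothO k g -> smoothO k (fun e x =>
  f e x + g e x).
Proof.
move=> [sf hf] [sg hg]; split=> [e|n]; first exact: (smoothD (sf e) (sg e)).
by under eq_fun do rewrite (derive1nD n (sf _) (sg _)); exact: bigOD.
Qed.

Lemma smoothOM k m f g : smoothO k f -> smoothO m g ->
  smoothO (k + m) (fun e x => f e x * g e x).
Proof.
move=> [sf hf] [sg hg]; split=> [e|n]; first exact: (smoothM (sf e) (sg e)).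
under eq_fun do rewrite (derive1nM n (sf _) (sg _)).
by apply: bigO_sum => i _; apply: bigOZ; exact: bigOM.
Qed.

Lemma smoothO_le k m f : (m <= k)%N -> smoothO k f -> smoothO m f.
Proof. by move=> mk [sf hf]; split=> // n; exact: bigO_le (hf n). Qed.

Lemma smoothO_smooth_cst (h : R -> R) : smooth h -> smoothO 0 (fun _ => h).
Proof.
move=> sh; split=> // n; apply: bigO_continuous; apply: smooth_continuous.
exact: smooth_derive1n.
Qed.

Lemma smoothO_cst (c : R) : smoothO 0 (fun _ _ => c).
Proof. by apply: smoothO_smooth_cst; exact: smooth_cst. Qed.

Lemma smoothO_scale k (s : R -> R) m f : bigO k (fun e _ => s e) -> smoothO m f ->
  smoothO (k + m) (fun e x => s e * f e x).
Proof.
move=> hs [sf hf]; split=> [e|n]; first exact: (@smoothZ _ _ _ (sf e)).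
by under eq_fun do rewrite (derive1nZ n _ (sf _)); exact: bigOM.
Qed.

Lemma smoothO_exp k m f : smoothO m f -> smoothO (k + m) (fun e x =>
  e ^+ k * f e x).
Proof. exact: (smoothO_scale (@bigO_exp k)). Qed.

Lemma smoothOZ k (c : R) f : smoothO k f -> smoothO k (fun e x => c * f e x).
Proof. exact: (smoothO_scale (@bigO_cst c)). Qed.

Lemma smoothO_div_exp k m f : smoothO (k + m) f -> smoothO m (fun e x =>
  f e x / e ^+ k).
Proof.
move=> [sf hf].
have E : (fun e x => f e x / e ^+ k) = (fun e x => (e ^+ k)^-1 * f e x).
  by apply/funext => e; apply/funext => x; rewrite mulrC.
rewrite E; split=> [e|n]; first exact: (@smoothZ _ _ _ (sf e)).
under eq_fun do rewrite (derive1nZ n _ (sf _)).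
move=> a b; have [C hC] := hf n a b; exists C.
move: hC (evloc_gt0 a b); apply: filterS2 => e h1 h2 x xab.
have e0 := h2 x xab.
rewrite normrM normfV (ger0_norm (exprn_ge0 _ (ltW e0))) mulrC.
by rewrite ler_pdivrMr ?exprn_gt0 // -mulrA -exprD addnC; exact: h1.
Qed.

Lemma smoothO_sum k (I : Type) (r : seq I) (F : I -> R -> R -> R) :
  (forall i, smoothO k (F i)) -> smoothO k (fun e x => \sum_(i <- r) F i e x).
Proof.
move=> hF; have sF e i : smooth (F i e) by have [] := hF i.
elim: r => [|i r IH].
  split=> [e|n]; first by under eq_fun do rewrite big_nil; exact: smooth_cst.
  apply: bigO_eq (bigO_0 k) => a b; near=> e => x _.
  by rewrite (derive1n_sum n _ (sF e)) big_nil.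
by apply: smoothO_eq (smoothOD (hF i) IH) => e x; rewrite big_cons.
Unshelve. all: by end_near. Qed.

(** Differentiation in x commutes with taking the Taylor remainder, so every x-derivative of the
    remainder is the remainder of a derivative of h, and [taylor_bound] applies to it. *)
Lemma smoothO_taylor N (p : R) (h : R -> R) : smooth h ->
  smoothO N (fun e x => h (x + p * e) - taylor N h x (p * e)).
Proof.
move=> sh.
have sF (e : R) (g : R -> R) (j : 'I_N) : smooth g ->
    smooth (fun x => (p * e) ^+ j / j`!%:R * derive1n j g x).
  by move=> sg; apply: smoothZ; exact: smooth_derive1n.
have st (e : R) (g : R -> R) : smooth g -> smooth (fun x => taylor N g x (p * e)).
  by move=> sg; apply: smooth_sum => j; exact: sF.
have Et (e : R) n : derive1n n (fun x => taylor N h x (p * e)) =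
    fun x => taylor N (derive1n n h) x (p * e).
  rewrite derive1n_sum => [|j]; last exact: sF.
  apply/funext => x; apply: eq_bigr => j _.
  rewrite derive1nZ; last exact: smooth_derive1n.
  by rewrite /derive1n -!iterD addnC.
split=> [e|n].
  exact: (smoothD (smooth_shift (p * e) sh).1 (smoothN (st e h sh))).
move=> a b.
(* For eps < 1 all points between x and x + p eps stay in the interval widened by |p|. *)
have [K hK] := continuous_bounded (a - `|p|) (b + `|p|)
  (smooth_continuous (@smooth_derive1n _ (N + n) _ sh)).
exists (K * `|p| ^+ N); near=> e => x xab.
have e0 : 0 < e by near: e; exact: nbhs_right_gt.
have e1 : e < 1 by near: e; exact: nbhs_right_lt.
have -> : derive1n n (fun x => h (x + p * e) - taylor N h x (p * e)) x =
   derive1n n h (x + p * e) - taylor N (derive1n n h) x (p * e).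
  rewrite (derive1nD n (smooth_shift (p * e) sh).1 (smoothN (st e h sh))).
  rewrite (smooth_shift (p * e) sh).2.
  under [X in _ + derive1n _ X _]eq_fun do rewrite -mulN1r.
  by rewrite (derive1nZ n (-1) (st e h sh)) Et mulN1r.
rewrite -mulrA -exprMn.
have -> : `|p| * e = `|p * e| by rewrite normrM (gtr0_norm e0).
apply: taylor_bound => [|y hy]; first exact: smooth_derive1n.
rewrite /derive1n -iterD; apply: hK.
have : `|y - x| <= `|p|.
  apply: le_trans hy _; rewrite normrM (gtr0_norm e0) ler_piMr // ltW //.
by move: xab; rewrite ler_norml => /andP[? ?] /andP[? ?]; apply/andP; split; lra.
Unshelve. all: by end_near. Qed.

Lemma smoothO_0 k : smoothO k (fun _ _ => 0).
Proof.
split=> [e|n]; first exact: smooth_cst.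
apply: bigO_eq (bigO_0 k) => a b; near=> e => x _.
by case: n => // n; rewrite derive1n_cst.
Unshelve. all: by end_near. Qed.

(** The exponent 2 is what the final precision asks for: the coefficient of Gamma' enters with a
    factor eps, so its error then contributes O(eps^3). *)
Definition approx2 (c : R) f := smoothO 2 (fun e x => f e x - c).

Lemma approx2_cst (c : R) : approx2 c (fun _ _ => c).
Proof. by apply: smoothO_eq (smoothO_0 2) => e x; rewrite subrr. Qed.

Lemma approx2_smoothO (c : R) f : approx2 c f -> smoothO 0 f.
Proof.
move=> hf; apply: smoothO_eq (smoothOD (smoothO_le (leq0n _) hf) (smoothO_cst c))
  => e x.
by rewrite subrK.
Qed.

Lemma approx2D (c c' : R) f g :
  approx2 c f -> approx2 c' g -> approx2 (c + c') (fun e x => f e x + g e x).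
Proof. by move=> hf hg; apply: smoothO_eq (smoothOD hf hg) => e x /=; ring. Qed.

Lemma approx2M (c c' : R) f g :
  approx2 c f -> approx2 c' g -> approx2 (c * c') (fun e x => f e x * g e x).
Proof.
move=> hf hg; have hgz := approx2_smoothO hg.
by apply: smoothO_eq (smoothOD (smoothOM hf hgz) (smoothOZ c hg)) => e x /=; ring.
Qed.

(* A constant and a family that is close to it are treated as one function on
   [option (R * R)], so that determinants of matrices of such pairs are covered
   by the pointwise closure lemmas. *)
Definition approx2_pair (h : option (R * R) -> R) :=
  approx2 (h None) (fun e x => h (Some (e, x))).

Lemma approx2_pairM (f g : option (R * R) -> R) :
  approx2_pair f -> approx2_pair g -> approx2_pair (fun t => f t * g t).
Proof. exact: approx2M. Qed.

Lemma approx2_det n (M : option (R * R) -> 'M[R]_n) :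
  (forall i j, approx2_pair (fun t => M t i j)) -> approx2_pair (fun t =>
    \det (M t)).
Proof.
apply: closed_det => [c|f g|f g]; rewrite /approx2_pair;
  [exact: approx2_cst|exact: approx2D|exact: approx2M].
Qed.

Lemma approx2_adj n (M : option (R * R) -> 'M[R]_n) :
  (forall i j, approx2_pair (fun t => M t i j)) ->
  forall i j, approx2_pair (fun t => \adj (M t) i j).
Proof.
apply: closed_adj => [c|f g|f g]; rewrite /approx2_pair;
  [exact: approx2_cst|exact: approx2D|exact: approx2M].
Qed.

Lemma approx2_sum (I : Type) (r : seq I) (F : I -> option (R * R) -> R) :
  (forall i, approx2_pair (F i)) -> approx2_pair (fun t => \sum_(i <- r) F i t).
Proof.
move=> hF; apply: closed_sum => [c|f g|i _]; rewrite ?/approx2_pair;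
  [exact: approx2_cst|exact: approx2D|exact: hF].
Qed.

End BigO.

(** * Determinants and companion matrices *)

Section MatrixBigO.
Context {R : realType} {n : nat}.
Implicit Types (A B D : R -> R -> 'M[R]_n) (k m : nat).

Definition mxO k A := forall i j, bigO k (fun e x => A e x i j).

Lemma mxOD k A B : mxO k A -> mxO k B -> mxO k (fun e x => A e x + B e x).
Proof.
move=> hA hB i j; under eq_fun do under eq_fun do rewrite mxE.
exact: bigOD.
Qed.

Lemma mxOM k m A B : mxO k A -> mxO m B -> mxO (k + m) (fun e x => A e x *m B e x).
Proof.
move=> hA hB i j; under eq_fun do under eq_fun do rewrite mxE.
by apply: bigO_sum => l _; exact: bigOM.
Qed.

Lemma mxOZ k m (s : R -> R -> R) A : bigO k s -> mxO m A ->
  mxO (k + m) (fun e x => s e x *: A e x).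
Proof.
move=> hs hA i j; under eq_fun do under eq_fun do rewrite mxE.
exact: bigOM.
Qed.

Lemma mxO_le k m A : (m <= k)%N -> mxO k A -> mxO m A.
Proof. by move=> mk hA i j; exact: bigO_le (hA i j). Qed.

Lemma mxO_cst (C : 'M[R]_n) : mxO 0 (fun _ _ => C).
Proof. by move=> i j; exact: bigO_cst. Qed.

Lemma mxO_tr k A : mxO k A -> bigO k (fun e x => \tr (A e x)).
Proof. by move=> hA; apply: bigO_sum => i _; exact: hA. Qed.

Lemma prod1D_expansion k (I : Type) (r : seq I) (F : I -> R -> R -> R) :
  (forall i, bigO k (F i)) ->
  bigO (k + k) (fun e x => \prod_(i <- r) (1 + F i e x) - 1 - \sum_(i <- r) F i e
    x).
Proof.
move=> hF; elim: r => [|i r IH].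
  apply: bigO_eq (bigO_0 (k + k)) => a b; near=> e => x _.
  by rewrite !big_nil subrr subr0.
have hS : bigO k (fun e x => \sum_(i <- r) F i e x).
  by apply: bigO_sum => j _; exact: hF.
have hP := bigOD (bigO_le (leq_addr k k) IH) hS.
apply: bigO_eq (bigOD IH (bigOM (hF i) hP)) => a b.
by near=> e => x _; rewrite !big_cons; ring.
Unshelve. all: by end_near. Qed.

(** In the Leibniz formula the identity contributes 1 + tr D up to products of two entries of D. Any
    other permutation moves some i and then also s(i), hence has two off-diagonal factors, each
    O(eps^k). *)
Lemma det1D_expansion k D : mxO k D ->
  bigO (k + k) (fun e x => \det (1%:M + D e x) - 1 - \tr (D e x)).
Proof.
move=> hD.
have hid := prod1D_expansion (index_enum 'I_n) (fun i => hD i i).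
have hs (s : {perm 'I_n}) : s != 1%g ->
  bigO (k + k) (fun e x => (-1) ^+ s * \prod_i (1%:M + D e x) i (s i)).
  move=> s1; have [i si] : exists i, s i != i.
    apply/existsP; rewrite -[X in is_true X]negbK negb_exists; apply: contra s1.
    by move=> /forallP h; apply/eqP/permP => i; rewrite perm1; apply/eqP;
      rewrite -[_ == _]negbK.
  have ssi : s (s i) != s i by apply: contra si => /eqP/perm_inj/eqP.
  apply: bigOZ.
  under eq_fun do under eq_fun do rewrite (bigD1 i) //= (bigD1 (s i)) //= mulrA.
  apply: bigOMr.
    apply: bigOM; under eq_fun do under eq_fun do rewrite !mxE.
      by rewrite eq_sym (negbTE si); apply: bigO_eq (hD i (s i)) => a b;
        near=> e => x _; rewrite add0r.
    by rewrite eq_sym (negbTE ssi); apply: bigO_eq (hD (s i) (s (s i))) => a b;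
      near=> e => x _; rewrite add0r.
  apply: bigO_prod => j _; under eq_fun do under eq_fun do rewrite !mxE.
  by apply: bigOD; [exact: bigO_cst|exact: bigO_le (hD _ _)].
apply: bigO_eq (bigOD hid (bigO_sum (index_enum _) hs)) => a b.
near=> e => x _; rewrite /determinant (bigD1 1%g) //= odd_perm1 expr0 mul1r.
rewrite /mxtrace; under eq_bigr do rewrite perm1 !mxE eqxx.
by ring.
Unshelve. all: by end_near. Qed.

End MatrixBigO.

Section Companion.
Context {R : fieldType} (d : nat) (v : nat -> R).

(** Row i expresses the derivative of Gamma^(i) in the frame Gamma, ..., Gamma^(d), the last row by
    means of L Gamma = 0. The diagonal is zero; in the last row this says that L has no term of
    order d. *)
Definition companion : 'M[R]_d.+1 :=
  \matrix_(i, j) if i == d :> nat then (if (j < d)%N then - v j else 0)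
                 else (i.+1 == j :> nat)%:R.

Definition companion_poly : {poly R} := 'X^(d.+1) + \poly_(i < d) v i.

Lemma size_companion_poly : size companion_poly = d.+2.
Proof.
by rewrite size_polyDl size_polyXn // ltnS (leq_trans (size_poly _ _)).
Qed.

Lemma char_poly_companion : char_poly companion = companion_poly.
Proof.
have mon : companion_poly \is monic.
  rewrite monicE lead_coefDl ?lead_coefXn // size_polyXn ltnS.
  by rewrite (leq_trans (size_poly _ _)).
rewrite -[RHS](companionmxK mon) /companionmx.
have : (size companion_poly).-1 = d.+1 by rewrite size_companion_poly.
(* [companionmx] has size [(size companion_poly).-1], which is d + 1 only up to a proof; abstracting
   it lets the two matrices be compared entrywise. *)
move: (size companion_poly).-1 => m em; subst m.
congr char_poly; apply/matrixP => i j; rewrite !mxE /=.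
case: eqP => // _; rewrite coefD coefXn coef_poly ltn_eqF ?ltn_ord // add0r.
by case: ifP => // _; rewrite oppr0.
Qed.

(** For t nonzero this is the reversed characteristic polynomial t^(d+1) chi(1/t). *)
Lemma det_1B_companion (t : R) :
  \det (1%:M - t *: companion) = 1 + \sum_(i < d) v i * t ^+ (d.+1 - i).
Proof.
have [->|t0] := eqVneq t 0.
  rewrite scale0r subr0 det1 big1 ?addr0 // => i _.
  by rewrite subSn ?expr0n ?mulr0 // ltnW.
have -> : 1%:M - t *: companion = t *: (t^-1%:M - companion).
  by rewrite scalerBr scale_scalar_mx mulfV.
rewrite detZ.
have -> : \det (t^-1%:M - companion) = (char_poly companion).[t^-1].
  rewrite /char_poly -horner_evalE -det_map_mx; congr (\det _).
  by apply/matrixP => i j; rewrite !mxE /= horner_evalE hornerD hornerN hornerC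
    hornerMn hornerX.
rewrite char_poly_companion /companion_poly hornerD hornerXn horner_poly mulrDr
  -exprMn mulfV // expr1n.
congr (_ + _); rewrite mulr_sumr; apply: eq_bigr => i _.
have -> : t ^+ d.+1 = t ^+ (d.+1 - i) * t ^+ i by rewrite -exprD subnK // ltnW //
  ltnS ltnW.
rewrite mulrCA -mulrA -exprMn mulfV // expr1n mulr1 //.
Qed.

End Companion.

(** * Wronskian matrices *)

Section CompanionTrace.
Context {R : fieldType} (d : nat) (v : nat -> R).

(** In the sum of all U_ij U_ji only the entries (d-1, d) and (d, d-1), equal to 1 and -v_(d-1),
    meet a nonzero partner; their product is counted twice. *)
Lemma tr_companion_sqr : (0 < d)%N ->
  \tr (companion d v *m companion d v) = - (v d.-1 *+ 2).
Proof.
move=> d0; have hs : \sum_(j < d) (j.+1 == d)%:R * - v j = - v d.-1.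
  have dd : (d.-1 < d)%N by rewrite prednK.
  rewrite (bigD1 (Ordinal dd)) //= prednK // eqxx mul1r big1 ?addr0 // => i.
  rewrite -val_eqE /= => id; case: eqP => [e|]; last by rewrite mul0r.
  by move: id; rewrite -[d in d.-1]e eqxx.
rewrite /mxtrace big_ord_recr /= mulr2n opprD; congr (_ + _).
  rewrite -hs; apply: eq_bigr => i _; rewrite mxE big_ord_recr /=.
  have ne (k : 'I_d) : (k == d :> nat) = false by rewrite ltn_eqF.
  rewrite !mxE /= ne eqxx ltn_ord big1 ?add0r // => j _; rewrite !mxE /= !ne.
  have [ij|] := eqVneq i.+1 (j : nat); last by rewrite mul0r.
  by rewrite -ij gtn_eqF ?mulr0 // ltnS leqnSn.
rewrite -hs mxE big_ord_recr /= [X in _ + X]mulrC !mxE /= ltnn eqxx mul0r addr0.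
apply: eq_bigr => j _; rewrite !mxE /= eqxx ltn_ord (@ltn_eqF j d) //.
by rewrite mulrC.
Qed.

End CompanionTrace.

Section Wronskian.
Context {R : realType} {n : nat}.
Implicit Types (F G : 'I_n -> R -> R) (c : R -> R).

Definition wronskian_mx F (x : R) : 'M[R]_n := \matrix_(i, k) derive1n i (F k) x.

(** Multiplication by [c] acting on jets of order less than n. It is triangular with [c] on the
    diagonal, so the Wronskian of c F is c^n times that of F. Above the diagonal, where i - j is
    truncated, the binomial is 0. *)
Definition leibniz_mx c (x : R) : 'M[R]_n :=
  \matrix_(i, j) ('C(i, j)%:R * derive1n (i - j) c x).

Lemma wronskian_mxM c F x : smooth c -> (forall k, smooth (F k)) ->
  wronskian_mx (fun k y => c y * F k y) x = leibniz_mx c x *m wronskian_mx F x.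
Proof.
move=> sc sF; apply/matrixP => i k; rewrite !mxE.
have := @derive1nM R i _ _ sc (sF k) => ->.
rewrite (big_ord_widen n (fun j : nat =>
  'C(i, j)%:R * (derive1n (i - j) c x * derive1n j (F k) x))) //.
rewrite big_mkcond /=; apply: eq_bigr => j _; rewrite !mxE; case: ifPn => [_|].
  by rewrite mulrA.
by rewrite -leqNgt => ij; rewrite bin_small // !mul0r.
Qed.

Lemma det_leibniz_mx c x : \det (leibniz_mx c x) = c x ^+ n.
Proof.
rewrite det_trig => [|]; last first.
  by apply/is_trig_mxP => i j ij; rewrite mxE bin_small // mul0r.
under eq_bigr do rewrite mxE binn mul1r subnn.
by rewrite prodr_const card_ord.
Qed.

Lemma wronskian_mx_sum (I : Type) (r : seq I) (H : I -> 'I_n -> R -> R) x :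
  (forall i k, smooth (H i k)) ->
  wronskian_mx (fun k y => \sum_(i <- r) H i k y) x = \sum_(i <- r) wronskian_mx
    (H i) x.
Proof.
move=> sH; apply/matrixP => i k; rewrite mxE summxE.
have := @derive1n_sum R i _ r (fun j => H j k) (fun j => sH j k) => ->.
by apply: eq_bigr => j _; rewrite mxE.
Qed.

Lemma smooth_adj_wronskian_mx F i j : (forall k, smooth (F k)) ->
  smooth (fun x => \adj (wronskian_mx F x) i j).
Proof.
move=> sF; apply: (@closed_adj R R smooth) => [c|f g|f g|k l].
- exact: smooth_cst.
- exact: smoothD.
- exact: smoothM.
- by under eq_fun do rewrite mxE; exact: smooth_derive1n.
Qed.

Lemma leibniz_mxO k (f : R -> R -> R) : smoothO k f ->
  mxO k (fun e x => leibniz_mx (f e) x).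
Proof.
move=> [_ hf] i j; under eq_fun do under eq_fun do rewrite mxE.
by apply: bigOZ; exact: hf.
Qed.

End Wronskian.

Arguments derive1n : simpl never.

Section WronskianMore.
Context {R : realType} {n : nat}.
Implicit Types (F G : 'I_n -> R -> R) (c : R -> R).

Lemma wronskian_mxD F G x : (forall k, smooth (F k)) -> (forall k, smooth (G k)) ->
  wronskian_mx (fun k y => F k y + G k y) x = wronskian_mx F x + wronskian_mx G x.
Proof.
move=> sF sG; apply/matrixP => i k; rewrite !mxE.
by have := @derive1nD R i _ _ (sF k) (sG k) => ->.
Qed.

Lemma leibniz_mx_cst (s : R) x : leibniz_mx (fun _ => s) x = s%:M :> 'M[R]_n.
Proof.
apply/matrixP => i j; rewrite !mxE -val_eqE /=.
case: ltngtP => [ij|ij|->]; last by rewrite binn subnn mul1r.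
- by rewrite bin_small // mul0r.
- by rewrite -[(i - j)%N]prednK ?subn_gt0 // derive1n_cst mulr0.
Qed.

Lemma leibniz_mx_1D (t : R) c x : smooth c ->
  leibniz_mx (fun y => 1 + t * c y) x = 1%:M + t *: leibniz_mx c x :> 'M[R]_n.
Proof.
move=> sc; rewrite -(leibniz_mx_cst 1 x); apply/matrixP => i j; rewrite !mxE.
rewrite (derive1nD _ (@smooth_cst R 1) (@smoothZ _ t _ sc)).
by rewrite (derive1nZ _ t sc) mulrDr; congr (_ + _); ring.
Qed.

End WronskianMore.

(** * Derivatives in the moving frame, and the Wronskian of a perturbed curve *)

Section Frame.
Context {R : realType} (d : nat) (g : 'I_d.+1 -> R -> R) (v : nat -> R -> R).
Hypothesis d0 : (0 < d)%N.
Hypothesis sg : forall k, smooth (g k).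
Hypothesis sv : forall i, (i < d)%N -> smooth (v i).
Hypothesis det_g : forall x, \det (wronskian_mx g x) = 1.
Hypothesis g_eq : forall k x,
  derive1n d.+1 (g k) x = - \sum_(i < d) v i x * derive1n i (g k) x.

Let A x := wronskian_mx g x.
Let U x := companion d (fun i => v i x).

(** The adjugate is the inverse because the Wronskian is 1, so row i holds the coordinates of
    Gamma^(l+i) in the frame. *)
Definition frame_mx l x := wronskian_mx (fun k =>
  derive1n l (g k)) x *m \adj (wronskian_mx g x).

Lemma wronskian_mx_derive1 x : wronskian_mx (fun k => derive1 (g k)) x = U x *m A x.
Proof.
apply/matrixP => i k; rewrite !mxE -derive1Sn big_ord_recr /= !mxE ltnn /=.
have [id|id] := eqVneq (i : nat) d.
  rewrite id mul0r addr0 g_eq -sumrN; apply: eq_bigr => j _.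
  by rewrite !mxE /= id eqxx ltn_ord mulNr.
have {}id : (i < d)%N by rewrite ltn_neqAle id -ltnS ltn_ord.
have [e|ne] := eqVneq i.+1 d.
  rewrite big1 => [|j _]; first by rewrite add0r mul1r e.
  by rewrite !mxE /= ltn_eqF // e gtn_eqF // mul0r.
rewrite mul0r addr0.
have iS : (i.+1 < d)%N by rewrite ltn_neqAle ne.
rewrite (bigD1 (Ordinal iS)) //= !mxE /= (@ltn_eqF i d) // eqxx mul1r.
rewrite big1 ?addr0 // => j; rewrite -val_eqE /= => ji.
by rewrite !mxE /= (@ltn_eqF i d) // eq_sym (negbTE ji) mul0r.
Qed.

Lemma mul_wronskian_mx_adj x : wronskian_mx g x *m \adj (wronskian_mx g x) = 1%:M.
Proof. by rewrite mul_mx_adj det_g. Qed.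

Lemma mul_adj_wronskian_mx x : \adj (wronskian_mx g x) *m wronskian_mx g x = 1%:M.
Proof. by rewrite mul_adj_mx det_g. Qed.

Lemma frame_mx0 x : frame_mx 0 x = 1%:M.
Proof. exact: mul_wronskian_mx_adj. Qed.

Lemma frame_mx1 x : frame_mx 1 x = U x.
Proof. by rewrite /frame_mx wronskian_mx_derive1 -mulmxA mul_wronskian_mx_adj
  mulmx1. Qed.

Lemma smooth_companion i j : smooth (fun x => U x i j).
Proof.
under eq_fun do rewrite mxE.
case: eqP => _; last exact: smooth_cst.
case: ltnP => jd; last exact: smooth_cst.
exact: (smoothN (sv jd)).
Qed.

Lemma wronskian_mx_derive2 x : wronskian_mx (fun k => derive1n 2 (g k)) x =
  ((\matrix_(i, j) derive1 (fun y => U y i j) x) + U x *m U x) *m A x.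
Proof.
rewrite mulmxDl -mulmxA -wronskian_mx_derive1; apply/matrixP => i k; rewrite 2!mxE.
have -> : derive1n i (derive1n 2 (g k)) x = derive1 (fun y => (U y *m A y) i k) x.
  have -> : (fun y => (U y *m A y) i k) = derive1n i.+1 (g k).
    by apply/funext => y; rewrite -wronskian_mx_derive1 mxE derive1Sn.
  by rewrite -derive1nS /derive1n -iterD addn2.
under eq_fun do rewrite mxE.
rewrite -derive1n1 derive1n_sum => [|j]; last first.
  apply: smoothM; first exact: smooth_companion.
  by under eq_fun do rewrite mxE; exact: smooth_derive1n.
rewrite !mxE -big_split /=; apply: eq_bigr => j _.
have sA : smooth (fun y => A y j k).
  by under eq_fun do rewrite mxE; exact: smooth_derive1n.
have := @derive1nM R 1 _ _ (@smooth_companion i j) sA => ->.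
rewrite !big_ord_recl big_ord0 addr0 /= !mul1r !mxE /A; congr (_ + _ * _).
- by rewrite derive1n1 derive1n0 mxE.
- by rewrite derive1n0 mxE.
- rewrite -derive1Sn derive1nS derive1n1; congr (derive1 _ x).
  by apply/funext => y; rewrite mxE.
Qed.

(** The matrix is U' + U^2, and U' contributes nothing since the diagonal of U is identically 0. *)
Lemma tr_frame_mx2 x : \tr (frame_mx 2 x) = - (v d.-1 x *+ 2).
Proof.
rewrite /frame_mx wronskian_mx_derive2 -mulmxA mul_wronskian_mx_adj mulmx1 mxtraceD.
rewrite tr_companion_sqr // [X in X + _]big1 ?add0r // => i _; rewrite mxE.
rewrite (_ : (fun _ => _) = fun=> 0) ?derive1_cst //.
apply/funext => y; rewrite mxE; case: eqP => [->|_]; rewrite ?ltnn //.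
by rewrite gtn_eqF.
Qed.

Lemma frame_mxO l : mxO 0 (fun _ => frame_mx l).
Proof.
move=> i j; apply: bigO_continuous; apply: smooth_continuous.
under eq_fun do rewrite mxE.
apply: smooth_sum => k; apply: smoothM; last exact: smooth_adj_wronskian_mx.
under eq_fun do rewrite mxE.
by apply: smooth_derive1n; exact: smooth_derive1n.
Qed.

Section Expansion.
Variables (a b : R) (h : R -> R -> R) (r : 'I_d.+1 -> R -> R -> R).
Hypothesis hO : smoothO 0 h.
Hypothesis rO : forall l, smoothO 3 (r l).

(** The form of a lift of the image before normalization: [a] and [b] will be alpha_11 and alpha_22,
    while [h] depends on eps and x and is to be removed by the normalization. *)
Definition near_curve e k (y : R) :=
  (1 + e ^+ 2 * h e y) * g k y + (e * a * derive1n 1 (g k) y +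
  (e ^+ 2 * b * derive1n 2 (g k) y + \sum_(l < d.+1) r l e y * derive1n l (g k) y)).

Lemma smooth_near_curve e k : smooth (near_curve e k).
Proof.
have sg' l : smooth (derive1n l (g k)) by exact: smooth_derive1n.
apply: smoothD.
  apply: smoothM; last exact: sg.
  by apply: smoothD; [exact: smooth_cst|apply: smoothZ; case: hO].
apply: smoothD; first exact: smoothZ.
apply: smoothD; first exact: smoothZ.
by apply: smooth_sum => l; apply: smoothM => //; case: (rO l).
Qed.

Definition near_frame e x : 'M[R]_d.+1 :=
  \sum_(l < d.+1) leibniz_mx (r l e) x *m frame_mx l x.

Lemma wronskian_mx_near_curve e x :
  wronskian_mx (near_curve e) x *m \adj (wronskian_mx g x) =
  1%:M + (e * a) *: U x +
  (e ^+ 2 *: (leibniz_mx (h e) x + b *: frame_mx 2 x) + near_frame e x).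
Proof.
have sh : smooth (h e) by case: hO.
have sg' l k : smooth (derive1n l (g k)) := @smooth_derive1n _ l _ (@sg k).
have s1 : smooth (fun y => 1 + e ^+ 2 * h e y).
  by apply: smoothD; [exact: smooth_cst|exact: smoothZ].
have sr l k : smooth (fun y => r l e y * derive1n l (g k) y).
  exact: (smoothM (proj1 (rO l) e) (sg' l k)).
pose f1 k y := (1 + e ^+ 2 * h e y) * g k y.
pose f2 k y := e * a * derive1n 1 (g k) y.
pose f3 k y := e ^+ 2 * b * derive1n 2 (g k) y.
pose f4 k y := \sum_(l < d.+1) r l e y * derive1n l (g k) y.
have sf1 k : smooth (f1 k) by exact: (smoothM s1 (@sg k)).
have sf2 k : smooth (f2 k) := @smoothZ _ (e * a) _ (@sg' 1%N k).
have sf3 k : smooth (f3 k) := @smoothZ _ (e ^+ 2 * b) _ (@sg' 2%N k).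
have sf4 k : smooth (f4 k) by exact: (@smooth_sum R _ _ _ (fun l => @sr l k)).
have sf34 k : smooth (fun y => f3 k y + f4 k y) by exact: (smoothD (sf3 k) (sf4 k)).
have sf24 k : smooth (fun y => f2 k y + (f3 k y + f4 k y)).
  exact: (smoothD (sf2 k) (sf34 k)).
rewrite [wronskian_mx _ x](@wronskian_mxD _ _ f1 (fun k y =>
  f2 k y + (f3 k y + f4 k y)) x sf1 sf24).
rewrite (@wronskian_mxD _ _ f2 (fun k y => f3 k y + f4 k y) x sf2 sf34).
rewrite (@wronskian_mxD _ _ f3 f4 x sf3 sf4) (@wronskian_mx_sum _ _ _ _ _ x sr).
rewrite [wronskian_mx f1 x](wronskian_mxM x s1 (@sg)) (leibniz_mx_1D _ _ sh).
rewrite [wronskian_mx f2 x](@wronskian_mxM R d.+1 (fun=> e * a) (fun k =>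
  derive1n 1 (g k)) x (@smooth_cst R _) (@sg' 1%N)).
rewrite [wronskian_mx f3 x](@wronskian_mxM R d.+1 (fun=> e ^+ 2 * b) (fun k =>
  derive1n 2 (g k)) x (@smooth_cst R _) (@sg' 2%N)).
rewrite !leibniz_mx_cst !mul_scalar_mx !mulmxDl -!scalemxAl mul1mx -!mulmxA.
rewrite -[wronskian_mx _ x *m _]/(frame_mx 0 x) -[wronskian_mx _ x *m
  _]/(frame_mx 1 x).
rewrite -[wronskian_mx _ x *m _]/(frame_mx 2 x) frame_mx0 mulmx1 frame_mx1.
rewrite mulmx_suml scalerDr scalerA.
have -> : \sum_(l < d.+1) wronskian_mx (fun k y =>
  r l e y * derive1n l (g k) y) x *m \adj (wronskian_mx g x)
  = near_frame e x.
  apply: eq_bigr => l _.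
  by rewrite (@wronskian_mxM R d.+1 (r l e) (fun k =>
    derive1n l (g k)) x (proj1 (rO l) e) (@sg' l)) -mulmxA.
by rewrite !addrA; do 2 congr (_ + _); rewrite addrAC.
Qed.

(** The term v_i (e a)^(d+1-i) of the determinant has order at least 3 unless i = d - 1. *)
Lemma bigO_det_companion :
  bigO 3 (fun e x => \det (1%:M - (e * a) *:
    U x) - 1 - e ^+ 2 * (a ^+ 2 * v d.-1 x)).
Proof.
have hv i : (i < d)%N -> bigO 0 (fun _ x => v i x).
  by move=> id; apply: bigO_continuous; apply: smooth_continuous; exact: sv.
have hS : bigO 3 (fun e x => \sum_(i < d.-1) e ^+ (d.+1 - i) * (a ^+ (d.+1 - i) *
  v i x)).
  apply: bigO_sum => i _; have id := ltn_ord i.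
  apply: (@bigO_le _ ((d.+1 - i) + (0 + 0))); first by lia.
  by apply/bigO_expM/bigOM; [exact: bigO_cst|apply: hv; lia].
apply: bigO_eq hS => a' b'; near=> e => x _; rewrite det_1B_companion.
have hsum (F : nat -> R) : \sum_(i < d) F i = \sum_(i < d.-1) F i + F d.-1.
  by rewrite -[in LHS](prednK d0) big_ord_recr.
rewrite (hsum (fun i => v i x * (e * a) ^+ (d.+1 - i))).
have -> : (d.+1 - d.-1 = 2)%N by lia.
under [in RHS]eq_bigr do rewrite mulrA -exprMn mulrC.
rewrite !exprMn; ring.
Unshelve. all: by end_near. Qed.

Lemma tr_leibniz_mx (c : R -> R) x : \tr (leibniz_mx c x :
  'M[R]_d.+1) = d.+1%:R * c x.
Proof.
rewrite /mxtrace; under eq_bigr do rewrite mxE binn subnn mul1r derive1n0.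
by rewrite sumr_const card_ord mulr_natl.
Qed.

(* Multiplying the frame matrix by 1 - e a U removes its term of order e, and
   det (1 - e a U) is known from the characteristic polynomial of U; this avoids
   the second elementary symmetric function of U. *)
Theorem wronskian_expansion :
  bigO 3 (fun e x => \det (wronskian_mx (near_curve e) x) -
    (1 + e ^+ 2 * (d.+1%:R * h e x + (a ^+ 2 - 2 * b) * v d.-1 x))).
Proof.
pose Y e x := leibniz_mx (h e) x + b *: frame_mx 2 x.
pose N := near_frame.
have UO : mxO 0 (fun _ => U).
  by move=> i j; apply: bigO_continuous; apply: smooth_continuous;
    exact: smooth_companion.
have YO : mxO 0 Y.
  apply: mxOD; first exact: leibniz_mxO.
  exact: (@mxOZ _ _ 0 0 _ _ (@bigO_cst R b) (frame_mxO 2)).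
have NO : mxO 3 N.
  move=> i j; under eq_fun do under eq_fun do rewrite summxE.
  apply: bigO_sum => l _; exact: (mxOM (leibniz_mxO (rO l)) (frame_mxO l)).
(* [T] collects what has order at least 3 in the product of 1 - e a U with 1 + e a U + e^2 Y + N;
   the terms e a U cancel and leave -e^2 a^2 U^2. *)
pose T e x := - (e ^+ 3 * a) *: (U x *m Y e x) + (1%:M - (e * a) *: U x) *m N e x.
have eaO : bigO 1 (fun e _ => e * a).
  exact: (bigOMr (@bigO_exp R 1) (@bigO_cst R a)).
have TO : mxO 3 T.
  apply: mxOD.
    apply: (@mxOZ _ _ 3 0 _ _ _ (mxOM UO YO)); apply: bigON.
    exact: (bigOMr (@bigO_exp R 3) (@bigO_cst R a)).
  apply: (@mxOM _ _ 0 3) => //; apply: mxOD; first exact: mxO_cst.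
  move=> i j; under eq_fun do under eq_fun do rewrite mxE [X in - X]mxE.
  by apply: bigON; exact: (bigO_le (leq0n 1) (bigOMr eaO (UO i j))).
pose D e x := e ^+ 2 *: (Y e x - a ^+ 2 *: (U x *m U x)) + T e x.
have DO : mxO 2 D.
  apply: mxOD; last exact: (mxO_le (leqnSn 2) TO).
  apply: (@mxOZ _ _ 2 0 _ _ (@bigO_exp R 2)); apply: mxOD => // i j.
  under eq_fun do under eq_fun do rewrite mxE [X in - X]mxE.
  by apply: bigON; apply: bigOZ; exact: (mxOM UO UO).
have E e x : (1%:M - (e * a) *:
  U x) *m (wronskian_mx (near_curve e) x *m \adj (wronskian_mx g x)) = 1%:M + D e x.
  rewrite wronskian_mx_near_curve /D /T -/(N e x) -/(Y e x).
  set u := U x; set y := Y e x; set w := N e x.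
  have e1 : (1%:M - (e * a) *: u) *m (1%:M + (e * a) *: u) =
      1%:M - (e ^+ 2 * a ^+ 2) *: (u *m u).
    rewrite mulmxBl !mulmxDr !mulmx1 mul1mx -scalemxAl -scalemxAr scalerA.
    by rewrite opprD addrA addrK; congr (_ - _ *: _); ring.
  have e2 : (1%:M - (e * a) *: u) *m (e ^+ 2 *: y) =
      e ^+ 2 *: y + - (e ^+ 3 * a) *: (u *m y).
    rewrite mulmxBl mul1mx -scalemxAl -scalemxAr scalerA scaleNr.
    by congr (_ - _ *: _); ring.
  rewrite mulmxDr e1 [(_ - _) *m (e ^+ 2 *: y + w)]mulmxDr e2 scalerBr scalerA.
  by rewrite !addrA; do 2 congr (_ + _); rewrite addrAC.
have dE e x : \det (1%:M - (e * a) *: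
  U x) * \det (wronskian_mx (near_curve e) x) = \det (1%:M + D e x).
  have := congr1 determinant (mul_wronskian_mx_adj x).
  by rewrite det_mulmx det_g mul1r det1 -E !det_mulmx => ->; rewrite mulr1.
pose q e x := \det (1%:M - (e * a) *: U x) - 1.
pose s e x := d.+1%:R * h e x + (a ^+ 2 - 2 * b) * v d.-1 x.
have vO : bigO 0 (fun _ => v d.-1).
  by apply: bigO_continuous; apply: smooth_continuous; apply: sv; rewrite prednK.
have sO : bigO 0 s.
  apply: bigOD; first exact: (bigOZ _ (smoothO_bigO hO)).
  exact: bigOZ.
have qO : bigO 2 q.
  apply: bigO_eq (bigOD (bigO_le (leqnSn 2) bigO_det_companion)
    (bigO_expM 2 (bigOZ (a ^+ 2) vO))) => a' b'.
  by near=> e => x _; rewrite subrK.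
have q2 := @bigO_small _ 0 q 1 ltr01 (bigO_le (leqnSn 1) qO).
(* As det (1 - e a U) = 1 + q is invertible for small e, the difference to be bounded is det (1 + D)
   - (1 + q) (1 + e^2 s), divided by 1 + q. *)
apply: bigO_eq (bigO_div (_ : bigO 3 (fun e x =>
  \det (1%:M + D e x) - (1 + q e x) * (1 + e ^+ 2 * s e x))) (bigO_le (leqnSn 1)
  qO)).
  apply: evloc_mono q2 => e x qx; rewrite -dE -/(s e x).
  have -> : \det (1%:M - (e * a) *: U x) = 1 + q e x by rewrite /q; ring.
  rewrite -mulrBr [(1 + _) * _]mulrC mulfK //.
  by apply: contraTneq qx => /eqP; rewrite addrC addr_eq0 => /eqP ->;
    rewrite normrN1 ltxx.
have h1 := bigO_le (isT : (3 <= 4)%N) (det1D_expansion DO).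
have h2 := bigO_le (isT : (3 <= 4)%N) (bigOM qO (bigO_expM 2 sO)).
apply: bigO_eq (bigOD h1 (bigOB (bigOB (mxO_tr TO) bigO_det_companion) h2)) =>
  a' b'.
near=> e => x _; rewrite -/(q e x) /D mxtraceD mxtraceZ !mxtraceD raddfN /=
  !mxtraceZ.
(* At order e^2 the trace of Y - a^2 U^2 is (d+1) h - 2 b v_(d-1) + 2 a^2 v_(d-1), and q takes away
   a^2 v_(d-1). *)
rewrite tr_leibniz_mx tr_frame_mx2 (tr_companion_sqr (v^~ x) d0 :
  \tr (U x *m U x) = _) /s.
ring.
Unshelve. all: by end_near. Qed.

End Expansion.
End Frame.

(** * The linear system of the pentagram map *)

Section Minors.
Context {R : realType} {d : nat} (chi : config R d).
Implicit Types (Psi : forall i : 'I_(cr chi), 'M[R]_((cq i).+1, d.+1)).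

(** As a function of [w] this is a linear form that vanishes on the row space of [B], so an equation
    satisfied on that subspace. Taking j < d - q_i for every i gives d equations in all. *)
Definition wedge_minor (q j : nat) (B : 'M[R]_(q.+1, d.+1)) (w : 'rV[R]_d.+1) : R :=
  \det (colsub (wedge_cols (q := q) j) (col_mx w B)).

Lemma wedge_minor_sum q j B w :
  @wedge_minor q j B w = \sum_l w 0 l * wedge_minor j B (delta_mx 0 l).
Proof.
rewrite /wedge_minor.
have E w' : \det (colsub (wedge_cols (q := q) j) (col_mx w' B)) =
  \sum_m w' 0 (wedge_cols (d := d) (q := q) j m) *
    cofactor (colsub (wedge_cols (q := q) j) (col_mx 0 B)) ord0 m.
  rewrite (expand_det_row _ ord0); apply: eq_bigr => m _; congr (_ * _).
    rewrite mxE -(col_mxEu w' B ord0); congr (col_mx _ _ _ _); exact: val_inj.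
  rewrite /cofactor; congr (_ * \det _); apply/matrixP => a b; rewrite !mxE.
  case: splitP => // k; rewrite [k]ord1 /= /bump /=; lia.
rewrite E; under [RHS]eq_bigr do rewrite E mulr_sumr.
rewrite exchange_big /=; apply: eq_bigr => m _.
rewrite (bigD1 (wedge_cols j m)) //= !mxE !eqxx mul1r big1 ?addr0 // => l lm.
by rewrite !mxE eqxx eq_sym (negbTE lm) mul0r mulr0.
Qed.

Lemma wedge_minor_span q j B (c : 'rV_q.+1) : @wedge_minor q j B (c *m B) = 0.
Proof.
apply/eqP/det0P; exists (row_mx 1%:M (- c)).
  apply/eqP => /(congr1 (fun v : 'rV_(1 + q.+1) => v 0 (lshift _ ord0))).
  by rewrite row_mxEl !mxE eqxx => /eqP; rewrite oner_eq0.
rewrite mulmx_colsub mul_row_col mul1mx mulNmx subrr.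
by apply/matrixP => i l; rewrite !mxE.
Qed.

Definition config_block Psi (i : 'I_(cr chi)) : 'M[R]_(d - cq i, d) :=
  \matrix_(j, l) wedge_minor j (Psi i) (delta_mx 0 (lift ord0 l)).

Definition config_block0 Psi (i : 'I_(cr chi)) : 'M[R]_(d - cq i, 1) :=
  \matrix_(j, l) wedge_minor j (Psi i) (delta_mx 0 ord0).

Definition config_mx Psi : 'M[R]_d :=
  castmx (cq_sum chi, erefl d) (\mxcol_(i < cr chi) config_block Psi i).

Definition config_col Psi : 'cV[R]_d :=
  castmx (cq_sum chi, erefl 1%N) (\mxcol_(i < cr chi) config_block0 Psi i).

(** The solution of the homogeneous system whose coordinate of index 0 is the determinant. It is
    polynomial in the entries of [Psi], so closeness to a constant passes to it without any
    division. *)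
Definition cramer Psi : 'rV[R]_d.+1 :=
  \row_k (if unlift ord0 k is Some l
          then - (\adj (config_mx Psi) *m config_col Psi) l 0
          else \det (config_mx Psi)).

Lemma castmx_mull (m m' n p : nat) (e : m = m') (M : 'M[R]_(m, n)) (B :
  'M[R]_(n, p)) :
  castmx (e, erefl) M *m B = castmx (e, erefl) (M *m B).
Proof. by case: m' / e; rewrite !castmx_id. Qed.

Lemma cramerP Psi (w : 'rV[R]_d.+1) :
  (forall i, exists c, w = c *m Psi i) ->
  forall k, \det (config_mx Psi) * w 0 k = w 0 0 * cramer Psi 0 k.
Proof.
move=> hw.
have E : config_mx Psi *m (\col_l w 0 (lift ord0 l)) = - w 0 0 *: config_col Psi.
  rewrite castmx_mull mxcol_mul; apply/matrixP => j l; rewrite mxE !castmxE !mxE.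
  move: (cast_ord _ j) => {}j; have [c wc] := hw (tagnat.sig1 j).
  have := wedge_minor_span (tagnat.sig2 j) (Psi (tagnat.sig1 j)) c.
  rewrite -wc wedge_minor_sum big_ord_recl addrC => /eqP;
    rewrite addr_eq0 -mulNr => /eqP <-.
  by apply: eq_bigr => m _; rewrite !mxE mulrC.
move=> k; rewrite mxE; case: unliftP => [l|] ->; last by rewrite mulrC.
have := congr1 (mulmx (\adj (config_mx Psi))) E.
rewrite mulmxA mul_adj_mx mul_scalar_mx -scalemxAr => /matrixP/(_ l 0).
by rewrite !mxE => ->; rewrite mulNr mulrN.
Qed.

Lemma approx2_cramer (Psi : option (R * R) -> forall i :
  'I_(cr chi), 'M[R]_((cq i).+1, d.+1)) :
  (forall i a k, approx2_pair (fun t => Psi t i a k)) ->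
  forall k, approx2_pair (fun t => cramer (Psi t) 0 k).
Proof.
move=> hP.
have hm i j (w : 'rV[R]_d.+1) : approx2_pair (fun t => wedge_minor j (Psi t i) w).
  apply: approx2_det => a b; under eq_fun do rewrite !mxE.
  by case: splitP => l _; [exact: approx2_cst|exact: hP].
have hM i j : approx2_pair (fun t => config_mx (Psi t) i j).
  by under eq_fun do rewrite castmxE !mxE; exact: hm.
have hb i j : approx2_pair (fun t => config_col (Psi t) i j).
  by under eq_fun do rewrite castmxE !mxE; exact: hm.
move=> k; under eq_fun do rewrite mxE.
case: unliftP => [l|] _; last exact: approx2_det.
under eq_fun do rewrite mxE -mulN1r.
apply: approx2_pairM; first exact: approx2_cst.
apply: approx2_sum => m; apply: approx2_pairM; last exact: hb.
exact: approx2_adj.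
Qed.

End Minors.

(** [bigO] sees only eps > 0, whereas [smoothO] also asks for smoothness at the other eps, where the
    families may differ, for instance at eps = 0 after a division by a power of eps. *)
Lemma smoothO_congr (R : realType) k (f g : R -> R -> R) :
  (forall e x, 0 < e -> f e x = g e x) -> (forall e, smooth (g e)) ->
  smoothO k f -> smoothO k g.
Proof.
move=> fg sg [_ hf]; split=> [|n]; first exact: sg.
apply: bigO_eq (hf n) => a b; move: (@evloc_gt0 R a b).
apply: filterS => e e0 x xab; congr (derive1n n _ x).
by apply/funext => y; rewrite fg // (e0 x xab).
Qed.

(** * Coordinates of neighbouring points of the curve in the moving frame *)

Section FrameCoordinates.
Context {R : realType} (d : nat) (g : 'I_d.+1 -> R -> R) (v : nat -> R -> R).
Hypothesis sg : forall k, smooth (g k).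
Hypothesis sv : forall i, (i < d)%N -> smooth (v i).
Hypothesis det_g : forall x, \det (wronskian_mx g x) = 1.
Hypothesis g_eq : forall k x,
  derive1n d.+1 (g k) x = - \sum_(i < d) v i x * derive1n i (g k) x.

Definition frame_coord (p e x : R) : 'rV[R]_d.+1 :=
  (\row_l g l (x + p * e)) *m \adj (wronskian_mx g x).

(* The second term has order e^(d+1) and vanishes for k = d, which leaves a
   relative error O(e^2) in every coordinate. *)
Lemma frame_coord_taylor p e x k : frame_coord p e x 0 k =
  (p * e) ^+ k / k`!%:R +
  ((p * e) ^+ d.+1 / d.+1`!%:R * companion d (v^~ x) ord_max k +
  \sum_l (g l (x + p * e) - taylor d.+2 (g l) x (p * e)) * \adj (wronskian_mx g
    x) l k).
Proof.
have T : \sum_l taylor d.+2 (g l) x (p * e) * \adj (wronskian_mx g x) l k =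
  (p * e) ^+ k / k`!%:R + (p * e) ^+ d.+1 / d.+1`!%:R * companion d (v^~ x)
    ord_max k.
  under eq_bigr do rewrite mulr_suml.
  rewrite exchange_big /= big_ord_recr /=; congr (_ + _); last first.
    rewrite -(frame_mx1 det_g g_eq) mxE mulr_sumr; apply: eq_bigr => l _.
    by rewrite !mxE derive1n1 -derive1Sn mulrA.
  under eq_bigr => j _ do (under eq_bigr do rewrite -mulrA; rewrite -mulr_sumr).
  rewrite (bigD1 k) //= [X in _ + X]big1 => [|j jk].
    have := mul_wronskian_mx_adj det_g x => /matrixP/(_ k k).
    rewrite !mxE eqxx mulr1n => h; rewrite addr0 -[RHS]mulr1 -h; congr (_ * _).
    by apply: eq_bigr => l _; rewrite !mxE.
  have h : \sum_l derive1n j (g l) x * \adj (wronskian_mx g x) l k = 0.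
    have := mul_wronskian_mx_adj det_g x => /matrixP/(_ j k).
    rewrite !mxE (negbTE jk) mulr0n => h; apply: etrans h.
    by apply: eq_bigr => l _; rewrite !mxE.
  by rewrite h mulr0.
rewrite addrA -T -big_split /= mxE; apply: eq_bigr => l _.
by rewrite [X in X * _]mxE -mulrDl; congr (_ * _); ring.
Qed.

Lemma approx2_frame_coord p (k : 'I_d.+1) :
  approx2 (p ^+ k / k`!%:R) (fun e x => frame_coord p e x 0 k / e ^+ k).
Proof.
have sadj i j : smooth (fun x => \adj (wronskian_mx g x) i j) by exact:
  smooth_adj_wronskian_mx.
(* The remainder is taken of order d + 2 so that division by eps^k, with k <= d, leaves O(eps^2). *)
have rO : smoothO d.+2 (fun e x =>
    \sum_l (g l (x + p * e) - taylor d.+2 (g l) x (p * e)) * \adj (wronskian_mx g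
      x) l k).
  apply: smoothO_sum => l; rewrite -[X in smoothO X]addn0; apply: smoothOM.
    exact: smoothO_taylor.
  by apply: smoothO_smooth_cst; exact: sadj.
have cO : smoothO (k + 2) (fun e x =>
  (p * e) ^+ d.+1 / d.+1`!%:R * companion d (v^~ x) ord_max k).
  have [kd|kd] := ltnP k d; last first.
    apply: smoothO_eq (smoothO_0 _) => e x; rewrite mxE eqxx ltnNge kd /=; ring.
  apply: (@smoothO_le _ (d.+1 + 0)); first by lia.
  apply: smoothO_scale; last by apply: smoothO_smooth_cst; exact: smooth_companion.
  apply: bigO_eq (bigOZ (p ^+ d.+1 / d.+1`!%:R) (@bigO_exp R d.+1)) => a b.
  by near=> e => x _; rewrite exprMn; ring.
have kd : (k + 2 <= d.+2)%N by have := ltn_ord k; lia.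
have fO := smoothO_div_exp (smoothOD cO (smoothO_le kd rO)).
apply: smoothO_congr fO => [e x e0|e].
  rewrite frame_coord_taylor.
  have : e ^+ k != 0 by rewrite expf_neq0 // gt_eqF.
  move: (_ + \sum_l _) => X; rewrite exprMn.
  by move: (e ^+ k) (k`!%:R^-1) => E F E0; field.
have sf : smooth (fun x => frame_coord p e x 0 k).
  under eq_fun do rewrite mxE.
  apply: smooth_sum => l; under eq_fun do rewrite mxE.
  exact: (smoothM (smooth_shift (p * e) (@sg l)).1 (sadj l k)).
have := smoothD (@smoothZ _ (e ^+ k)^-1 _ sf) (@smooth_cst R (- (p ^+ k / k`!%:R))).
by under eq_fun do rewrite mulrC.
Unshelve. all: by end_near. Qed.

End FrameCoordinates.

(** * Roots of functions close to 1, and constancy of sign *)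

Section Root.
Context {R : realType}.
Implicit Types (l p s : R -> R -> R).

(** The cofactor 1 + x + ... + x^n is at least 1. *)
Lemma dist1_le_expn (x : R) n : 0 < x -> `|x - 1| <= `|x ^+ n.+1 - 1|.
Proof.
move=> x0; rewrite subrX1 normrM ler_peMr //.
rewrite ger0_norm ?sumr_ge0 // => [|i _]; last by rewrite exprn_ge0 // ltW.
by rewrite big_ord_recl expr0 lerDl sumr_ge0 // => i _; rewrite exprn_ge0 // ltW.
Qed.

Lemma bigO_expn1 k l n : bigO k (fun e x => l e x - 1) ->
  bigO k (fun e x => l e x ^+ n - 1).
Proof.
move=> hl; elim: n => [|n IH].
  by apply: bigO_eq (bigO_0 k) => a b; near=> e => x _; rewrite expr0 subrr.
apply: bigO_eq (bigOD (bigO_le (leq_addr k k) (bigOM IH hl)) (bigOD IH hl)) => a b.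
by near=> e => x _; rewrite exprSr; ring.
Unshelve. all: by end_near. Qed.

(** First l - 1 = O(e^2) by [dist1_le_expn], where positivity excludes a root near -1. Then l^(n+1)
    - 1 differs from (n+1) (l - 1) by l - 1 times the sum of the l^i - 1, that is by O(e^4). *)
Lemma bigO_root n l p s :
  evloc (fun e x => 0 < l e x) ->
  evloc (fun e x => l e x ^+ n.+1 * (1 + p e x) = 1) ->
  bigO 0 s -> bigO 3 (fun e x => p e x - e ^+ 2 * s e x) ->
  bigO 3 (fun e x => l e x - 1 + e ^+ 2 * s e x / n.+1%:R).
Proof.
move=> l0 lp sO ps.
have pO : bigO 2 p.
  apply: bigO_eq (bigOD (bigO_le (leqnSn 2) ps) (bigO_expM 2 sO)) => a b.
  by near=> e => x _; rewrite subrK.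
have p1 := bigO_le (leqnSn 1) pO.
have p_small := @bigO_small _ 0 p 1 ltr01 p1.
have E : evloc (fun e x => l e x ^+ n.+1 - 1 = - p e x / (1 + p e x)).
  apply: evloc_mono (evloc_and lp p_small) => e x [h1 h2].
  have h3 : 1 + p e x != 0.
    by apply: contraTneq h2 => /eqP; rewrite addrC addr_eq0 => /eqP ->;
      rewrite normrN1 ltxx.
  apply: (mulIf h3); rewrite mulrBl h1 mul1r divfK //; ring.
have rO : bigO 2 (fun e x => l e x ^+ n.+1 - 1).
  exact: bigO_eq E (bigO_div (bigON pO) p1).
have r3 : bigO 3 (fun e x => l e x ^+ n.+1 - 1 + e ^+ 2 * s e x).
  apply: bigO_eq (bigOB (bigO_le (isT :
    (3 <= 4)%N) (bigO_div (bigOM pO pO) p1)) ps).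
  apply: evloc_mono (evloc_and E p_small) => e x [-> h2].
  have h3 : 1 + p e x != 0.
    by apply: contraTneq h2 => /eqP; rewrite addrC addr_eq0 => /eqP ->;
      rewrite normrN1 ltxx.
  by field.
have l2 : bigO 2 (fun e x => l e x - 1).
  by apply: bigO_bound rO; apply: evloc_mono l0 => e x; exact: dist1_le_expn.
have sumO : bigO 2 (fun e x => \sum_(i < n.+1) (l e x ^+ i - 1)).
  by apply: bigO_sum => i _; exact: bigO_expn1.
have := bigOZ n.+1%:R^-1 (bigOB r3 (bigO_le (isT : (3 <= 4)%N) (bigOM l2 sumO))).
apply: bigO_eq => a b; near=> e => x _.
rewrite subrX1 sumrB sumr_const card_ord mulrBr.
have : (n.+1%:R : R) != 0 by rewrite pnatr_eq0.
by move: (\sum_(i < n.+1) _) n.+1%:R => S N N0; field.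
Unshelve. all: by end_near. Qed.

Lemma continuous_pos (f : R -> R) (a b : R) : continuous f ->
  (forall x, a <= x <= b -> f x != 0) -> 0 < f a ->
  forall x, a <= x <= b -> 0 < f x.
Proof.
move=> cf f0 fa x /andP[ax xb]; rewrite ltNge; apply/negP => fx.
have [|c] := @IVT R f a x 0 ax (continuous_subspaceT cf).
  by rewrite ge_min fx orbT /= le_max (ltW fa).
rewrite in_itv /= => /andP[ac cx] fc.
by have := f0 c; rewrite ac (le_trans cx xb) fc eqxx => /(_ isT).
Qed.

End Root.

(** * The expansion of the normalized lift *)

Section Limit.
Context {R : realType} (d : nat) (chi : config R d).
Hypothesis hd : (2 <= d)%N.
Hypothesis hchi : nondegenerate_config chi.

Definition limit_rows (i : 'I_(cr chi)) : 'M[R]_((cq i).+1, d.+1) :=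
  \matrix_(a < (cq i).+1) gvec (cp chi i a).

Definition limit_coef (k : 'I_d.+1) : R :=
  cramer limit_rows 0 k / \det (config_mx limit_rows).

Lemma limit_det : \det (config_mx limit_rows) != 0.
Proof. by move: hchi; rewrite /nondegenerate_config unitmxE unitfE. Qed.

Lemma limit_coef0 : limit_coef ord0 = 1.
Proof. by rewrite /limit_coef mxE unlift_none mulfV // limit_det. Qed.

Variables (g : 'I_d.+1 -> R -> R) (v : nat -> R -> R).
Hypothesis sg : forall k, smooth (g k).
Hypothesis sv : forall i, (i < d)%N -> smooth (v i).
Hypothesis det_g : forall x, \det (wronskian_mx g x) = 1.
Hypothesis g_eq : forall k x,
  derive1n d.+1 (g k) x = - \sum_(i < d) v i x * derive1n i (g k) x.

Definition scaled_rows (e x : R) (i : 'I_(cr chi)) : 'M[R]_((cq i).+1, d.+1) :=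
  \matrix_(a, k) (frame_coord g (cp chi i a) e x 0 k / e ^+ k).

(** Dividing by the limit determinant, a nonzero constant, instead of the determinant of the system
    itself keeps this polynomial in the rows. The price is a coefficient of index 0 equal to 1 +
    O(eps^2) rather than 1; the excess over eps^2 is [curve_height]. *)
Definition curve_coef (k : 'I_d.+1) (e x : R) : R :=
  cramer (scaled_rows e x) 0 k / \det (config_mx limit_rows).

Lemma approx2_curve_coef k : approx2 (limit_coef k) (curve_coef k).
Proof.
pose rows t := if t is Some (e, x) then scaled_rows e x else limit_rows.
have : approx2_pair (fun t => cramer (rows t) 0 k * (\det (config_mx
  limit_rows))^-1).
  apply: approx2_pairM; last exact: approx2_cst.
  apply: approx2_cramer => i a l.
  apply: smoothO_eq (approx2_frame_coord sg sv det_g g_eq (cp chi i a) l) => e x.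
  by rewrite !mxE.
by [].
Qed.

(** Dividing the k-th frame coordinate by eps^k is one linear map applied to [G] and to the spanning
    points alike, so the rescaled vector lies in the span of the rescaled rows and [cramerP]
    applies. *)
Lemma curve_coefP e x (G : 'rV[R]_d.+1) :
  (forall i, exists c, G = c *m \matrix_(a, l) g l (x + cp chi i a * e)) -> 0 < e ->
  forall l, curve_coef ord0 e x * G 0 l =
    (G *m \adj (wronskian_mx g x)) 0 ord0 *
    \sum_(k < d.+1) e ^+ k * curve_coef k e x * derive1n k (g l) x.
Proof.
move=> hG e0 l; set w := G *m _.
pose sw := \row_(k < d.+1) (w 0 k / e ^+ k).
have ek (k : 'I_d.+1) : e ^+ k != 0 by rewrite expf_neq0 // gt_eqF.
have hsw i : exists c, sw = c *m scaled_rows e x i.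
  have [c Gc] := hG i; exists c; apply/rowP => k;
    rewrite mxE /w Gc -mulmxA mxE [RHS]mxE mulr_suml.
  apply: eq_bigr => a _; rewrite -mulrA [scaled_rows _ _ _ _ _]mxE;
    congr (_ * (_ / _)).
  rewrite mxE [RHS]mxE; apply: eq_bigr => m _; congr (_ * _).
  by rewrite !mxE.
have H k : curve_coef ord0 e x * w 0 k = w 0 0 * (e ^+ k * curve_coef k e x).
  have := cramerP hsw k; rewrite [sw 0 k]mxE [sw 0 0]mxE expr0 divr1 => E.
  have {}E : \det (config_mx (scaled_rows e x)) * w 0 k =
      w 0 0 * cramer (scaled_rows e x) 0 k * e ^+ k.
    by rewrite -E -mulrA divfK.
  rewrite {1}/curve_coef mxE unlift_none.
  by rewrite mulrAC E /curve_coef; ring.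
have -> : G 0 l = \sum_k w 0 k * derive1n k (g l) x.
  have -> : G = w *m wronskian_mx g x by rewrite -mulmxA mul_adj_wronskian_mx //
    mulmx1.
  by rewrite mxE; apply: eq_bigr => k _; rewrite [wronskian_mx _ _ _ _]mxE.
rewrite !mulr_sumr; apply: eq_bigr => k _.
by rewrite mulrA H -mulrA.
Qed.

Definition alpha11 : R := limit_coef (inord 1).
Definition alpha22 : R := limit_coef (inord 2).

Definition curve_height (e x : R) : R := (curve_coef ord0 e x - 1) / e ^+ 2.

(** Index 0 leaves nothing because its deviation is already in [curve_height]; indices 1 and 2 leave
    errors of order 3 and 4; the remaining terms have order at least 3 as they stand. *)
Definition curve_rest (k : 'I_d.+1) (e x : R) : R :=
  if k == 0 :> nat then 0 else
  if k == 1 :> nat then e ^+ 1 * (curve_coef k e x - alpha11) else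
  if k == 2 :> nat then e ^+ 2 * (curve_coef k e x - alpha22) else
  e ^+ k * curve_coef k e x.

Lemma curve_coef0O : smoothO 2 (fun e x => curve_coef ord0 e x - 1).
Proof. by have := approx2_curve_coef ord0; rewrite limit_coef0. Qed.

Lemma curve_heightO : smoothO 0 curve_height.
Proof. exact: (@smoothO_div_exp R 2 0 _ curve_coef0O). Qed.

Lemma curve_restO k : smoothO 3 (curve_rest k).
Proof.
have hk := approx2_curve_coef k; rewrite /curve_rest.
have [k0|k0] := eqVneq (k : nat) 0%N; first exact: smoothO_0.
have [k1|k1] := eqVneq (k : nat) 1%N.
  apply: (@smoothO_exp R 1 2); suff <- : limit_coef k = alpha11 by [].
  by congr limit_coef; apply: val_inj; rewrite /= inordK // ltnS ltnW.
have [k2|k2] := eqVneq (k : nat) 2%N.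
  apply: (@smoothO_le R 4) => //; apply: (@smoothO_exp R 2 2).
  suff <- : limit_coef k = alpha22 by [].
  by congr limit_coef; apply: val_inj; rewrite /= inordK.
apply: (@smoothO_le R (k + 0)); first by lia.
apply: smoothO_exp; exact: approx2_smoothO hk.
Qed.

Lemma curve_coef_near e x l : 0 < e ->
  \sum_(k < d.+1) e ^+ k * curve_coef k e x * derive1n k (g l) x =
  near_curve g alpha11 alpha22 curve_height curve_rest e l x.
Proof.
move=> e0; have en : e != 0 by rewrite gt_eqF.
have i1 : (inord 1 : 'I_d.+1) = 1%N :> nat by rewrite inordK // ltnS ltnW.
have i2 : (inord 2 : 'I_d.+1) = 2%N :> nat by rewrite inordK.
pose t (k : 'I_d.+1) := e ^+ k * curve_coef k e x - curve_rest k e x.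
have E : \sum_(k < d.+1) t k * derive1n k (g l) x =
   curve_coef ord0 e x * g l x + (e * alpha11 * derive1n 1 (g l) x +
     e ^+ 2 * alpha22 * derive1n 2 (g l) x).
  rewrite (bigD1 ord0) //= (bigD1 (inord 1)) -?val_eqE /= ?i1 //.
  rewrite (bigD1 (inord 2)) -?val_eqE /= ?i1 ?i2 // big1 ?addr0.
    rewrite /t /curve_rest /= i1 i2 /= derive1n0.
    by congr (_ * _ + (_ * _ + _ * _)); ring.
  move=> k; rewrite -!val_eqE /= i1 i2 => /andP[/andP[k0 k1] k2].
  by rewrite /t /curve_rest (negbTE k0) (negbTE k1) (negbTE k2) subrr mul0r.
have -> : \sum_(k < d.+1) e ^+ k * curve_coef k e x * derive1n k (g l) x =
    \sum_(k < d.+1) t k * derive1n k (g l) x +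
    \sum_(k < d.+1) curve_rest k e x * derive1n k (g l) x.
  by rewrite -big_split /=; apply: eq_bigr => k _; rewrite -mulrDl subrK.
rewrite E /near_curve /curve_height !addrA; congr (_ * _ + _ + _ + _).
by field.
Qed.

Variables (Geps : R -> R -> 'rV[R]_d.+1) (eps0 : R).
Hypothesis eps0_gt0 : 0 < eps0.
Hypothesis Geps_smooth : forall e l, 0 < e < eps0 -> smooth (fun x => Geps e x 0 l).
Hypothesis Geps_det : forall e x, 0 < e < eps0 ->
  \det (wronskian_mx (fun l y => Geps e y 0 l) x) = 1.
Hypothesis Geps_in : forall e x, 0 < e < eps0 -> forall i,
  exists c, Geps e x = c *m \matrix_(a, l) g l (x + cp chi i a * e).
Hypothesis Geps_cvg : forall x l, Geps e x 0 l @[e --> 0^'+] --> g l x.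

(** The frame coordinate of [Geps] along Gamma; its quotient by [curve_coef] at index 0 is the
    normalizing factor lambda. *)
Definition curve_scale (e x : R) :
  R := (Geps e x *m \adj (wronskian_mx g x)) 0 ord0.

Let V e l x := near_curve g alpha11 alpha22 curve_height curve_rest e l x.

Lemma smooth_curve_scale e : 0 < e < eps0 -> smooth (curve_scale e).
Proof.
move=> he; rewrite /curve_scale; under eq_fun do rewrite mxE.
apply: smooth_sum => l.
exact: (smoothM (@Geps_smooth e l he) (@smooth_adj_wronskian_mx _ _ _ _ _ (@sg))).
Qed.

Lemma curve_scaleP e x l : 0 < e < eps0 ->
  curve_coef ord0 e x * Geps e x 0 l = curve_scale e x * V e l x.
Proof.
move=> he; have /andP[e0 _] := he.
by rewrite (curve_coefP (Geps_in x he) e0) curve_coef_near.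
Qed.

(** Wronskians of the two sides of [curve_scaleP]: a scalar factor comes out to the power d + 1, and
    [Geps] has Wronskian 1. *)
Lemma curve_scale_wronskian e x : 0 < e < eps0 ->
  curve_coef ord0 e x ^+ d.+1 = curve_scale e x ^+ d.+1 * \det (wronskian_mx (V
    e) x).
Proof.
move=> he.
have sc : smooth (curve_coef ord0 e) by have := approx2_smoothO
  (approx2_curve_coef ord0); case.
have E : wronskian_mx (fun l y => curve_coef ord0 e y * Geps e y 0 l) x =
   wronskian_mx (fun l y => curve_scale e y * V e l y) x.
  congr wronskian_mx; apply/funext => l; apply/funext => y; exact: curve_scaleP.
have sV l : smooth (V e l) := @smooth_near_curve _ _ _ (@sg) _ _ _ _
  curve_heightO curve_restO e l.
rewrite (wronskian_mxM x sc (fun l => @Geps_smooth e l he)) in E.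
rewrite [RHS](wronskian_mxM x (smooth_curve_scale he) sV) in E.
have := congr1 determinant E; rewrite !det_mulmx !det_leibniz_mx.
by rewrite Geps_det // mulr1.
Qed.

Lemma evloc_eps0 : evloc (fun e _ => 0 < e < eps0).
Proof.
apply: evloc_mono (evloc_and (@evloc_gt0 R) (evloc_lt eps0_gt0)) => e _ [-> ->].
by [].
Qed.

Lemma curve_coef0_pos : evloc (fun e x => 0 < curve_coef ord0 e x).
Proof.
have := @bigO_small _ 1 _ 1 ltr01 (smoothO_bigO curve_coef0O).
by apply: evloc_mono => e x; rewrite ltr_norml => /andP[]; lra.
Qed.

(** In its own frame Gamma has coordinate 1 along itself. *)
Lemma curve_scale_cvg x : curve_scale e x @[e --> 0^'+] --> (1 : R).
Proof.
have -> : 1 = \sum_l g l x * \adj (wronskian_mx g x) l ord0 :> R.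
  have := mul_wronskian_mx_adj det_g x => /matrixP/(_ ord0 ord0).
  rewrite !mxE eqxx mulr1n => <-; apply: eq_bigr => l _.
  by rewrite !mxE.
rewrite /curve_scale; under eq_fun do rewrite mxE.
apply: cvg_big => [|l _]; first exact: add_continuous.
apply: cvgM; [exact: Geps_cvg|exact: cvg_cst].
Qed.

(* The scale tends to 1 only pointwise, but it has no zero on [a, b], so its sign
   there is the sign at a. *)
Lemma curve_scale_pos : evloc (fun e x => 0 < curve_scale e x).
Proof.
move=> a b.
have h1 : \forall e \near 0^'+, 0 < curve_scale e a.
  by have /cvgr_gt := @curve_scale_cvg a; apply; exact: ltr01.
move: h1 (evloc_and evloc_eps0 curve_coef0_pos a b).
apply: filterS2 => e h1 h2 x xab.
have he : 0 < e < eps0 by have [] := h2 x xab.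
apply: continuous_pos h1 x xab => [|y yab].
  exact: smooth_continuous (smooth_curve_scale he).
(* By the Wronskian identity a zero of the scale would be a zero of [curve_coef] at index 0, which
   is positive. *)
have [_ c0] := h2 y yab; apply: contraTneq c0 => s0.
have := @curve_scale_wronskian e y he.
rewrite s0 expr0n mul0r => /eqP; rewrite expf_eq0 /= => /eqP ->.
by rewrite ltxx.
Qed.

Theorem Geps_expansion l : bigO 3 (fun e x => Geps e x 0 l -
  (g l x + e * (alpha11 * derive1n 1 (g l) x) + e ^+ 2 *
    (alpha22 * (derive1n 2 (g l) x + 2 / d.+1%:R * v d.-1 x * g l x) -
     alpha11 ^+ 2 / d.+1%:R * v d.-1 x * g l x))).
Proof.
pose lam e x := curve_scale e x / curve_coef ord0 e x.
pose m x := (alpha11 ^+ 2 - 2 * alpha22) / d.+1%:R * v d.-1 x.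
pose h := curve_height; pose r := curve_rest.
pose s e x := d.+1%:R * h e x + (alpha11 ^+ 2 - 2 * alpha22) * v d.-1 x.
have nz : (d.+1%:R : R) != 0 by rewrite pnatr_eq0.
have hO : bigO 0 h := smoothO_bigO curve_heightO.
have vO : bigO 0 (fun _ => v d.-1).
  by apply: bigO_continuous; apply: smooth_continuous; apply: sv; lia.
have mO : bigO 0 (fun _ => m) by exact: bigOZ.
have sO : bigO 0 s by apply: bigOD; exact: bigOZ.
have gO n : bigO 0 (fun _ => derive1n n (g l)).
  by apply: bigO_continuous; apply: smooth_continuous; exact: smooth_derive1n.
have lam0 : evloc (fun e x => 0 < lam e x).
  apply: evloc_mono (evloc_and curve_scale_pos curve_coef0_pos) => e x [h1 h2].
  exact: divr_gt0.
pose p e x := \det (wronskian_mx (V e) x) - 1.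
have lamp : evloc (fun e x => lam e x ^+ d.+1 * (1 + p e x) = 1).
  apply: evloc_mono (evloc_and evloc_eps0 curve_coef0_pos) => e x [h1 h2].
  rewrite /p addrC subrK /lam expr_div_n mulrAC -curve_scale_wronskian // divff //.
  by rewrite expf_neq0 // gt_eqF.
have pO : bigO 3 (fun e x => p e x - e ^+ 2 * s e x).
  have d0 : (0 < d)%N by lia.
  have := wronskian_expansion d0 (@sg) sv det_g g_eq alpha11 alpha22
    curve_heightO curve_restO.
  apply: bigO_eq => a b; near=> e => x _; rewrite /p /s /V /h; ring.
(* Since s / (d+1) = h + m, this says that lam = 1 - e^2 (h + m) + tau with tau = O(e^3). *)
have tauO := bigO_root lam0 lamp sO pO.
pose tau e x := lam e x - 1 + e ^+ 2 * s e x / d.+1%:R.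
pose rho e x := \sum_(k < d.+1) r k e x * derive1n k (g l) x.
have rhoO : bigO 3 rho.
  apply: bigO_sum => k _; apply: bigOMr (gO k); exact: smoothO_bigO (curve_restO k).
have e2O : bigO 0 (fun e _ => e ^+ 2) := bigO_le (leq0n 2) (@bigO_exp R 2).
have e1O : bigO 0 (fun e _ => e) := bigO_le (leq0n 1) (@bigO_exp R 1).
have cO c : bigO 0 (fun _ _ => c) := @bigO_cst R c.
have VO : bigO 0 (fun e x => V e l x).
  apply: bigOD; first exact: (bigOM (bigOD (cO 1) (bigOM e2O hO)) (gO 0%N)).
  apply: bigOD; first exact: (bigOM (bigOM e1O (cO _)) (gO 1%N)).
  apply: bigOD; first exact: (bigOM (bigOM e2O (cO _)) (gO 2%N)).
  exact: bigO_le rhoO.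
have e3 f : bigO 0 f -> bigO 3 (fun e x => e ^+ 3 * f e x) := @bigO_expM R 3 0 f.
(* The part of order at least 3 of (1 - e^2 (h + m)) (V - rho), divided by e^3. At order 2 the terms
   h g have cancelled and -m g remains. *)
pose rem e x := - (h e x + m x) * (alpha11 * derive1n 1 (g l) x) -
  e * ((h e x + m x) * (alpha22 * derive1n 2 (g l) x) + h e x * (h e x + m x) * g
    l x).
have hmO : bigO 0 (fun e x => h e x + m x) by exact: bigOD.
have remO : bigO 0 rem.
  apply: bigOB; first exact: (bigOM (bigON hmO) (bigOM (cO _) (gO 1%N))).
  apply: (bigOM e1O); apply: bigOD.
    exact: (bigOM hmO (bigOM (cO _) (gO 2%N))).
  exact: (bigOM (bigOM hO hmO) (gO 0%N)).
have := bigOD (bigOD (e3 _ remO) (bigOM tauO VO))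
  (bigOMl (_ : bigO 0 (fun e x => 1 - e ^+ 2 * (h e x + m x))) rhoO).
have H : evloc (fun e x => Geps e x 0 l = (1 - e ^+ 2 * (h e x + m x) + tau e x)
  * V e l x).
  apply: evloc_mono (evloc_and evloc_eps0 curve_coef0_pos) => e x [h1 h2].
  have c0 : curve_coef ord0 e x != 0 by rewrite gt_eqF.
  apply: (mulfI c0); rewrite curve_scaleP // mulrA; congr (_ * _).
  rewrite /tau /lam /s /m; field; exact/andP.
move=> X; apply: bigO_eq (X _).
  apply: evloc_mono H => e x ->; rewrite /V /near_curve -/h -/(rho e x) /rem
    -/(tau e x).
  by rewrite /m; move: (d.+1%:R^-1) => N; ring.
exact: (bigOB (cO 1) (bigOM e2O hmO)).
Unshelve. all: by end_near. Qed.

End Limit.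

(** * From row vectors and operator symbols to components *)

Section Components.
Context {R : realType} {n : nat}.
Implicit Types (G : R -> 'rV[R]_n).

Lemma derive1_component G x k : derivable G x 1 ->
  derivable (fun y => G y 0 k) x 1 /\
  derive1 (fun y => G y 0 k) x = derive1 G x 0 k.
Proof.
move=> dG; split; first by move/derivable_mxP: dG; apply.
by rewrite !derive1E derive_mx // mxE.
Qed.

Lemma derive1n_component G m k : smooth G ->
  (fun x => derive1n m G x 0 k) = derive1n m (fun y => G y 0 k).
Proof.
move=> sG; elim: m => [//|m IH]; apply/funext => x.
by rewrite !derive1nS -IH (derive1_component k (sG m x)).2.
Qed.

Lemma smooth_component G k : smooth G -> smooth (fun y => G y 0 k).
Proof.
move=> sG m x; rewrite -derive1n_component //.
exact: (derive1_component k (sG m x)).1.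
Qed.

End Components.

Lemma wronskianE (R : realType) d (G : R -> 'rV[R]_d.+1) x : smooth G ->
  wronskian G x = \det (wronskian_mx (fun k y => G y 0 k) x).
Proof.
move=> sG; congr (\det _); apply/matrixP => i k; rewrite !mxE.
by rewrite -derive1n_component.
Qed.

Section DactTheory.
Context {R : realType} {V : normedModType R}.
Implicit Types (A B : diffop R) (f : R -> V).

Lemma dactE m A f x : (size A <= m)%N ->
  dact A f x = \sum_(j < m) (A`_j : R -> R) x *: derive1n j f x.
Proof.
move=> Am; rewrite /dact (big_ord_widen m (fun j => (A`_j : R -> R) x *:
  derive1n j f x)) //.
rewrite big_mkcond /=; apply: eq_bigr => j _; case: ifPn => //.
by rewrite -leqNgt => /(nth_default 0) ->; rewrite scale0r.
Qed.

Lemma dactD A B f x : dact (A + B) f x = dact A f x + dact B f x.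
Proof.
pose m := maxn (size A) (size B).
rewrite (dactE _ _ (size_polyD A B)) (dactE _ _ (leq_maxl _ (size B))) (dactE _ _
  (leq_maxr (size A) _)).
by rewrite -big_split /=; apply: eq_bigr => j _; rewrite coefD -scalerDl.
Qed.

Lemma dact0 f x : dact 0 f x = 0.
Proof. by rewrite /dact size_poly0 big_ord0. Qed.

Lemma dact_sum (I : Type) (r : seq I) (F : I -> diffop R) f x :
  dact (\sum_(i <- r) F i) f x = \sum_(i <- r) dact (F i) f x.
Proof.
elim: r => [|i r IH]; first by rewrite !big_nil dact0.
by rewrite !big_cons dactD IH.
Qed.

Lemma dactZXn (c : R -> R) m f x : dact (c *: 'X^m) f x = c x *: derive1n m f x.
Proof.
rewrite (@dactE m.+1) => [|]; last by rewrite (leq_trans (size_scale_leq _ _)) //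
  size_polyXn.
rewrite big_ord_recr /= coefZ coefXn eqxx mulr1 big1 ?add0r // => j _.
by rewrite coefZ coefXn ltn_eqF // mulr0 scale0r.
Qed.

Lemma dactXn m f x : dact 'X^m f x = derive1n m f x.
Proof. by rewrite -['X^m]scale1r dactZXn scale1r. Qed.

Lemma dactC (c : R -> R) f x : dact c%:P f x = c x *: f x.
Proof. by rewrite -[c%:P]mulr1 -[1]/'X^0 -scale_polyE ?mul_polyC dactZXn. Qed.

Lemma dact_Lop d (u : nat -> R -> R) f x :
  dact (Lop d u) f x = derive1n d.+1 f x + \sum_(i < d) u i x *: derive1n i f x.
Proof.
rewrite dactD dactXn dact_sum; congr (_ + _).
by apply: eq_bigr => i _; rewrite dactZXn.
Qed.

Lemma dact_Q2op d (u : nat -> R -> R) f x :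
  dact (Q2op d u) f x = derive1n 2 f x + (2 / d.+1%:R * u d.-1 x) *: f x.
Proof. by rewrite dactD dactXn dactC. Qed.

Lemma dactZ (c : R -> R) A f x : dact (c *: A) f x = c x *: dact A f x.
Proof.
rewrite (dactE _ _ (size_scale_leq c A)) scaler_sumr; apply: eq_bigr => j _.
by rewrite coefZ scalerA.
Qed.

Lemma dactN A f x : dact (- A) f x = - dact A f x.
Proof.
rewrite /dact size_polyN -sumrN; apply: eq_bigr => j _.
by rewrite coefN -scaleNr.
Qed.

End DactTheory.

Lemma dact_component (R : realType) n (A : diffop R) (G : R -> 'rV[R]_n) x k :
  smooth G -> dact A G x 0 k = dact A (fun y => G y 0 k) x.
Proof.
move=> sG; rewrite /dact summxE; apply: eq_bigr => j _; rewrite mxE.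
by rewrite -derive1n_component.
Qed.

Section Setting.
Context {R : realType} {d : nat} (chi : config R d).

Lemma span_atP (gamma : R -> RP R d) (Gamma : R -> 'rV[R]_d.+1) e i x G :
  (forall x, line (gamma x) = <[Gamma x]>%VS) ->
  G \in span_at (chi := chi) gamma e i x ->
  exists c, G = c *m \matrix_(a, l) Gamma (x + cp chi i a * e) 0 l.
Proof.
move=> hl /memv_sumP[vs hvs ->].
have /choice[c hc] : forall a, exists c, vs a = c *: Gamma (x + cp chi i a * e).
  by move=> a; apply/vlineP; rewrite -hl; exact: hvs.
exists (\row_a c a); apply/rowP => l; rewrite summxE mxE.
by apply: eq_bigr => a _; rewrite hc !mxE.
Qed.

End Setting.

Lemma near_rightP (R : realType) (P : R -> Prop) :
  (\forall e \near 0^'+, P e) <-> exists2 r : R, 0 < r & forall e, 0 < e < r -> P e.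
Proof.
split=> [|[r r0 h]]; last first.
  near=> e; apply: h; apply/andP; split; near: e;
    [exact: nbhs_right_gt|exact: nbhs_right_lt].
rewrite /at_right near_withinE => /nbhs_ballP[r /= r0 h];
  exists r => // e /andP[e0 er].
by apply: h => //; rewrite /ball /= sub0r normrN gtr0_norm.
Unshelve. all: by end_near. Qed.

Lemma rV_norm_le (R : realType) n (w : 'rV[R]_n) : `|w| <= \sum_k `|w 0 k|.
Proof.
rewrite [leLHS]/Num.Def.normr /= mx_normrE; apply: bigmax_le => [|[i j] _].
  by apply: sumr_ge0 => k _; exact: normr_ge0.
by rewrite /= ord1 (bigD1 j) //= lerDl sumr_ge0 // => k _; exact: normr_ge0.
Qed.

Lemma rV_norm_ge (R : realType) n (w : 'rV[R]_n) k : `|w 0 k| <= `|w|.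
Proof.
rewrite {2}/Num.Def.normr /= mx_normrE.
exact: (le_bigmax _ (fun i : 'I_1 * 'I_n => `|w i.1 i.2|) (0, k)).
Qed.

(** * Uniqueness of the expansion, and the expansion in a pentagram setting *)

Section BigOUniqueness.
Context {R : realType}.

Lemma bigO_at k (f : R -> R -> R) (x0 : R) : bigO k f -> bigO k (fun e _ => f e x0).
Proof.
move=> hf a b; have [C hC] := hf x0 x0; exists C.
by move: hC; apply: filterS => e h x _; apply: h; rewrite lexx.
Qed.

Lemma bigO_divX k m (f : R -> R -> R) : bigO (k + m) f ->
  bigO m (fun e x => f e x / e ^+ k).
Proof.
move=> hf a b; have [C hC] := hf a b; exists C.
move: hC (@evloc_gt0 R a b); apply: filterS2 => e h1 h2 x xab.
have e0 := h2 x xab.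
rewrite normrM normfV (ger0_norm (exprn_ge0 _ (ltW e0))).
by rewrite ler_pdivrMr ?exprn_gt0 // -mulrA -exprD addnC; exact: h1.
Qed.

Lemma bigO1_cst (c : R) : bigO 1 (fun _ _ => c) -> c = 0.
Proof.
move=> hc; apply/eqP; rewrite -normr_le0 leNgt; apply/negP => c0.
have /near_rightP[r r0 /(_ (r / 2))] := bigO_small c0 hc 0 0.
have -> : 0 < r / 2 < r by lra.
by move=> /(_ isT 0); rewrite lexx ltxx => /(_ isT).
Qed.

Lemma bigO3_quadratic (a b : R) : bigO 3 (fun e _ => e * a + e ^+ 2 * b) ->
  a = 0 /\ b = 0.
Proof.
move=> h.
have a0 : a = 0.
  apply: bigO1_cst.
  have h1 := bigO_divX (k := 1) (m := 1) (bigO_le (isT : (2 <= 3)%N) h).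
  apply: bigO_eq (bigOB h1 (bigO_expM 1 (@bigO_cst R b))).
  apply: evloc_mono (@evloc_gt0 R) => e x e0; rewrite !expr1.
  by field; rewrite gt_eqF.
split=> //; apply: bigO1_cst; apply: bigO_eq (bigO_divX (k := 2) (m := 1) h).
apply: evloc_mono (@evloc_gt0 R) => e x e0; rewrite a0.
by field; rewrite gt_eqF.
Qed.

End BigOUniqueness.

Section Setting.
Context {R : realType} {d : nat} {chi : config R d}.
Hypothesis hd : (2 <= d)%N.
Context {gamma : R -> RP R d} {Gamma : R -> 'rV[R]_d.+1} {u : nat -> R -> R}
  {Geps : R -> R -> 'rV[R]_d.+1}.
Hypothesis S : pentagram_setting chi gamma Gamma u Geps.

Definition component k x := Gamma x 0 k.

Lemma setting_smooth : smooth Gamma.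
Proof. by have [] := ps_lift S. Qed.

Lemma setting_smooth_u i : (i < d)%N -> smooth (u i).
Proof. by have [h _ _] := ps_eq S; exact: h. Qed.

Lemma setting_component k : smooth (component k).
Proof. exact: (@smooth_component _ _ _ k setting_smooth). Qed.

Lemma setting_det x : \det (wronskian_mx component x) = 1.
Proof. by have [s _ h] := ps_lift S; rewrite -(h x) wronskianE. Qed.

Lemma setting_eq k x : derive1n d.+1 (component k) x =
  - \sum_(i < d) u i x * derive1n i (component k) x.
Proof.
have [_ _ /(_ x)] := ps_eq S => /(congr1 (fun w : 'rV_d.+1 => w 0 k)).
rewrite dact_component; last exact: setting_smooth.
by rewrite dact_Lop mxE => /eqP; rewrite addr_eq0 => /eqP.
Qed.

Lemma expansion_component G1 G2 k : expansion Gamma Geps G1 G2 ->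
  bigO 3 (fun e x => Geps e x 0 k - (component k x +
    e * dact G1 (component k) x + e ^+ 2 * dact G2 (component k) x)).
Proof.
move=> [_ _ h] a b; have [C [r [r0 hC]]] := h a b; exists C.
apply/near_rightP; exists r => // e er x xab.
apply: le_trans (hC e x er xab); apply: le_trans (rV_norm_ge _ k).
have sG := setting_smooth.
by rewrite !mxE !dact_component.
Qed.

Lemma component_expansion (G1 G2 : diffop R) :
  (size G1 <= d.+1)%N -> (size G2 <= d.+1)%N ->
  (forall k, bigO 3 (fun e x => Geps e x 0 k - (component k x +
    e * dact G1 (component k) x + e ^+ 2 * dact G2 (component k) x))) ->
  expansion Gamma Geps G1 G2.
Proof.
move=> s1 s2 h; split=> // a b.
have hs : bigO 3 (fun e x => \sum_k `|Geps e x 0 k - (component k x +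
    e * dact G1 (component k) x + e ^+ 2 * dact G2 (component k) x)|).
  apply: bigO_sum => k _; apply: bigO_bound (h k) => a' b'.
  by near=> e => x _; rewrite normr_id.
have [C /near_rightP[r r0 hC]] := hs a b; exists C, r; split=> // e x er xab.
apply: le_trans (hC e er x xab).
apply: le_trans (ler_norm _).
apply: le_trans (rV_norm_le _) _; apply: ler_sum => k _.
have sG := setting_smooth.
by rewrite !mxE !dact_component.
Unshelve. all: by end_near. Qed.

(** The bound on the orders makes the differences of coefficients at x a row vector of length d + 1,
    which the invertible Wronskian matrix sends to 0. *)
Lemma dact_component_inj (A B : diffop R) :
  (size A <= d.+1)%N -> (size B <= d.+1)%N ->
  (forall k x, dact A (component k) x = dact B (component k) x) -> A = B.
Proof.
move=> sA sB h; apply/polyP => j.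
have [jd|jd] := ltnP j d.+1; last by rewrite !nth_default // (leq_trans _ jd).
apply/funext => x.
pose c : 'rV[R]_d.+1 := \row_i ((A`_i : R -> R) x - (B`_i : R -> R) x).
have c0 : c *m wronskian_mx component x = 0.
  apply/rowP => k; rewrite !mxE.
  have := h k x; rewrite (dactE _ _ sA) (dactE _ _ sB) => /eqP.
  rewrite -subr_eq0 -sumrB => /eqP E; apply: etrans E; apply: eq_bigr => i _.
  by rewrite !mxE mulrBl.
have : c = 0.
  by rewrite -[c]mulmx1 -(mul_wronskian_mx_adj setting_det x) mulmxA c0 mul0mx.
by move=> /rowP/(_ (Ordinal jd)); rewrite !mxE => /eqP; rewrite subr_eq0 => /eqP.
Qed.

Lemma expansion_unique G1 G2 H1 H2 : expansion Gamma Geps G1 G2 ->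
  expansion Gamma Geps H1 H2 -> G1 = H1 /\ G2 = H2.
Proof.
move=> hG hH; have [sG1 sG2 _] := hG; have [sH1 sH2 _] := hH.
have E k x : dact G1 (component k) x = dact H1 (component k) x /\
    dact G2 (component k) x = dact H2 (component k) x.
  have := @bigO_at _ _ _ x (bigOB (expansion_component k hH) (expansion_component
    k hG)).
  move=> h; suff [/eqP] : dact G1 (component k) x - dact H1 (component k) x = 0 /\
           dact G2 (component k) x - dact H2 (component k) x = 0.
    by rewrite subr_eq0 => /eqP -> /eqP; rewrite subr_eq0 => /eqP ->.
  apply: bigO3_quadratic; apply: bigO_eq h => a b.
  by near=> e => y _; ring.
by split; apply: dact_component_inj => // k x; have [] := E k x.
Unshelve. all: by end_near. Qed.

Hypothesis hchi : nondegenerate_config chi.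

Lemma setting_expansion :
  expansion Gamma Geps (cst (alpha11 chi) *: 'X)
    (cst (alpha22 chi) *: Q2op d u -
       (fun x => alpha11 chi ^+ 2 / d.+1%:R * u d.-1 x)%:P).
Proof.
apply: component_expansion => [||k].
- by rewrite (leq_trans (size_scale_leq _ _)) // size_polyX ltnS ltnW.
- rewrite (leq_trans (size_polyD _ _)) // geq_max size_polyN.
  rewrite (leq_trans (size_polyC_leq1 _)) // andbT (leq_trans (size_scale_leq _
    _)) //.
  rewrite (leq_trans (size_polyD _ _)) // geq_max size_polyXn ltnS hd.
  by rewrite (leq_trans (size_polyC_leq1 _)).
have [[e0 e0_gt0 hG] hlim] := ps_image S.
have [_ hline _] := ps_lift S.
have sv : forall i, (i < d)%N -> smooth (u i) by exact: setting_smooth_u.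
have := @Geps_expansion R d chi hd hchi component u setting_component sv
  setting_det setting_eq Geps e0 e0_gt0 _ _ _ _ k.
have X : forall e l, 0 < e < e0 -> smooth (fun x => Geps e x 0 l).
  by move=> e l /hG[s _ _]; exact: smooth_component.
move=> /(_ X) H; apply: bigO_eq (H _ _ _) => [a b|e x he|e x he i|x l].
- near=> e => x _; rewrite (dactZXn _ 1) dactD dactN dactZ dactC dact_Q2op /=.
  rewrite /GRing.scale /=; ring.
- by have [s _ h] := hG e he; rewrite -(h x) wronskianE.
- have [_ hp _] := hG e he.
  have : Geps e x \in pentagram chi e gamma x by rewrite hp memv_line.
  move=> /(subvP (bigcapv_inf i isT (subvv _)))/(span_atP hline)[c ->].
  by exists c.
- rewrite /component.
  have := cvg_comp (Geps^~ x) (fun M : 'rV[R]_d.+1 => M ord0 l) (hlim x).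
  by apply; exact: coord_continuous.
Unshelve. all: by end_near. Qed.

End Setting.

(** * The differential part of the square of the root of L *)

Section Lop.
Context {R : realType}.

Lemma size_Lop_rest d (u : nat -> R -> R) :
  (size (\sum_(i < d) u i *: 'X^i : diffop R)%R <= d)%N.
Proof.
apply: (leq_trans (size_sum _ _ _)); apply/bigmax_leqP => i _.
by rewrite (leq_trans (size_scale_leq _ _)) // size_polyXn.
Qed.

Lemma size_Lop d (u : nat -> R -> R) : size (Lop d u) = d.+2.
Proof. by rewrite size_polyDl size_polyXn // ltnS (leq_trans (size_Lop_rest _
  _)). Qed.

Lemma coef_Lop d (u : nat -> R -> R) i : (i < d)%N -> (Lop d u)`_i = u i.
Proof.
move=> id; rewrite coefD coefXn ltn_eqF ?(ltn_trans id) // add0r coef_sum.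
rewrite (bigD1 (Ordinal id)) //= coefZ coefXn eqxx mulr1 big1 ?addr0 // => j ji.
rewrite coefZ coefXn; case: eqP => [e|_]; last by rewrite mulr0.
by move: ji; rewrite -val_eqE /= e eqxx.
Qed.

End Lop.

Section PseudoDifferential.
Context {R : realType}.

Lemma binz0 (z : int) : binz z 0 = 1 :> R.
Proof. by rewrite /binz big_ord0 fact0 divr1. Qed.

(** Up to index 2, the composition differentiates only the coefficients of [B] of index 0 and 1,
    which are constant; so the coefficients of index 2 simply add. *)
Lemma psi_mul_root (K B : psido (R := R)) (c : R -> R) :
  pcoef K 0 = cst 1 -> pcoef K 1 = cst 0 ->
  pcoef B 0 = cst 1 -> pcoef B 1 = cst 0 -> pcoef B 2 = c ->
  [/\ pcoef (psi_mul K B) 0 = cst 1, pcoef (psi_mul K B) 1 = cst 0 &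
      pcoef (psi_mul K B) 2 = fun x => pcoef K 2 x + c x].
Proof.
move=> K0 K1 B0 B1 B2.
have D1 n x : derive1n n.+1 (pcoef B 0) x = 0 by rewrite B0 derive1n_cst.
have D0 n x : derive1n n (pcoef B 1) x = 0.
  by rewrite B1; case: n => // n; rewrite derive1n_cst.
split; apply/funext => x /=;
  under eq_bigr do rewrite big_mkcond;
  rewrite !(big_ord_recl, big_ord0) /= ?subnn ?subn0;
  rewrite ?subSS ?subn0 ?D1 ?D0 ?K1 ?mulr0 ?mul0r ?binz0 ?K0 ?derive1n0 ?B0 ?B2
    /=; ring.
Qed.

Lemma psi_exp_root (K : psido (R := R)) n :
  pord K = 1 -> pcoef K 0 = cst 1 -> pcoef K 1 = cst 0 ->
  [/\ pord (psi_exp K n) = n%:Z, pcoef (psi_exp K n) 0 = cst 1,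
      pcoef (psi_exp K n) 1 = cst 0 &
      pcoef (psi_exp K n) 2 = fun x => n%:R * pcoef K 2 x].
Proof.
move=> Kp K0 K1; elim: n => [|n [IHp IH0 IH1 IH2]].
  by split=> //; apply/funext => x; rewrite mul0r.
have [h0 h1 h2] := psi_mul_root K0 K1 IH0 IH1 IH2.
split=> //; first by rewrite /= IHp Kp; lia.
by rewrite [LHS]h2; apply/funext => x; rewrite mulrS; ring.
Qed.

(** From K^(d+1) = L, the coefficient b of D^(-1) in K satisfies (d+1) b = u_(d-1), and the
    differential part of K^2 is D^2 + 2 b. *)
Lemma kdvQ2_root d (u : nat -> R -> R) K : (2 <= d)%N ->
  psi_root d.+1 (Lop d u) K -> kdvQ 2 K = Q2op d u.
Proof.
move=> hd [Kp [K0 K1] _ KL].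
have [_ _ _ hL] := psi_exp_root d.+1 Kp K0 K1.
have [hp h0 h1 h2] := psi_exp_root 2 Kp K0 K1.
have Kb : pcoef K 2 = fun x => u d.-1 x / d.+1%:R.
  move: hL; rewrite KL /psi_of /= size_Lop /= ltnW ?ltnS // coef_Lop; last by lia.
  have -> : (d.+1 - 2 = d.-1)%N by lia.
  move=> E; apply/funext => x; have := congr1 (fun f => f x) E => /= ->.
  by rewrite mulrC mulKf // pnatr_eq0.
rewrite /kdvQ /psi_plus; move: (psi_exp K 2) hp h0 h1 h2 => P -> h0 h1 h2.
apply/polyP => j; rewrite coef_poly coefD coefXn coefC.
case: j => [|[|[|j]]] //=; rewrite ?subn0 ?subnn ?h0 ?h1 ?h2 ?Kb ?addr0 //.
by rewrite add0r; apply/funext => x; ring.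
Qed.

End PseudoDifferential.

(** * Symmetry of mixed partial derivatives *)

Section Strip.
Context {R : realType} (t0 t1 : R).

Let D : set (R * R) := [set p | t0 < p.1 < t1].

Lemma near_strip (t : R) : t0 < t < t1 -> \forall s \near t, t0 < s < t1.
Proof.
move=> /andP[h1 h2]; near=> s; apply/andP; split; near: s.
  exact: lt_nbhsr.
exact: lt_nbhsl.
Unshelve. all: by end_near. Qed.

(** The strip is open in t, so equality on it passes to t-derivatives. This serves
    [Cn_on_component]: taking a component commutes with a derivative where the derivative is known
    to exist, that is on the strip. *)
Lemma Cn_on_ext (V : normedModType R) n (f h : R -> R -> V) :
  (forall t x, t0 < t < t1 -> f t x = h t x) -> Cn_on n D f -> Cn_on n D h.
Proof.
have cont (F H : R -> R -> V) : (forall t x, t0 < t < t1 -> F t x = H t x) ->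
    (forall p, D p -> {for p, continuous (fun q : R * R => F q.1 q.2)}) ->
    forall p, D p -> {for p, continuous (fun q : R * R => H q.1 q.2)}.
  move=> FH cF p Dp; rewrite /prop_for /continuous_at -FH //.
  apply: cvg_trans (cF p Dp); apply: near_eq_cvg.
  have : \forall q \near p, D q.
    exact: (@cvg_fst _ _ (nbhs p.1) (nbhs p.2) _ _ (near_strip Dp)).
  by apply: filterS => q Dq; exact: FH.
elim: n f h => [|n IH] f h fh [cf df]; split; try exact: cont cf; rewrite //.
have [d1 c1 c2] := df.
have nf t x : t0 < t < t1 -> \forall s \near t, f s x = h s x.
  by move=> tt; apply: filterS (near_strip tt) => s; exact: fh.
have fht t : t0 < t < t1 -> f t = h t by move=> tt; apply/funext => x; exact: fh.
split.
- move=> p Dp; have [a b] := d1 p Dp; rewrite -fht //; split=> //.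
  by apply: near_eq_derivable a; exact: nf.
- by apply: IH c1 => t x tt; rewrite !derive1E; apply: near_eq_derive; exact: nf.
- by apply: IH c2 => t x tt; rewrite fht.
Qed.

Lemma mvt_seg (f df : R -> R) (a b : R) : a < b ->
  (forall y, a <= y <= b -> is_derive y 1 f (df y)) ->
  exists2 c, a <= c <= b & f b - f a = df c * (b - a).
Proof.
move=> ab fd.
have [||c] := @MVT R f df a b ab.
- by move=> y; rewrite in_itv /= => /andP[y1 y2]; apply: fd; rewrite !ltW.
- apply: derivable_within_continuous => y; rewrite in_itv /= => yab.
  by have [] := fd y yab.
by rewrite in_itv /= => /andP[c1 c2] E; exists c => //; rewrite !ltW.
Qed.

Lemma dist_lt_itv (z w h m : R) : h < m -> z <= w <= z + h -> `|w - z| < m.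
Proof.
move=> hm /andP[zw wz]; rewrite ger0_norm ?subr_ge0 //.
by apply: le_lt_trans hm; rewrite lerBlDl.
Qed.

(** Schwarz's argument: the second difference of f on a square of side h is h^2 times either mixed
    derivative, each at some point of the square. Both are continuous at (t, x), so on a small
    square they would lie within less than |A - B| / 2 of [A] and [B], which is absurd. *)
Lemma partial_derive_comm (f : R -> R -> R) t x : t0 < t < t1 -> Cn_on 2 D f ->
  derive1 (fun y => derive1 (f^~ y) t) x = derive1 (fun s => derive1 (f s) x) t.
Proof.
move=> tt [_ [d1 [_ [d2 _ [c12 _]]] [_ [d3 [c21 _] _]]]].
set A := LHS; set B := RHS; apply/eqP; rewrite -subr_eq0 -normr_le0 leNgt;
  apply/negP => AB.
pose e := `|A - B| / 2.
have e0 : 0 < e by rewrite divr_gt0.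
pose ftx s y := derive1 (fun y => derive1 (f^~ y) s) y.
pose fxt s y := derive1 (fun s => derive1 (f s) y) s.
have near_close (F : R -> R -> R) : {for (t, x), continuous (fun q :
  R * R => F q.1 q.2)} ->
    exists2 r : R, 0 < r & forall s y,
      `|s - t| < r -> `|y - x| < r -> `|F s y - F t x| < e.
  move=> /cvgrPdist_lt/(_ e e0) /nbhs_ballP[r /= r0 h]; exists r => // s y hs hy.
  by rewrite distrC; apply: (h (s, y)); split; rewrite /ball /= distrC.
have [r1 r10 h1] := near_close ftx (c12 (t, x) tt).
have [r2 r20 h2] := near_close fxt (c21 (t, x) tt).
(* This radius keeps the square inside the strip. *)
have [/= r3 r30 h3] := (nbhs_ballP _ _).1 (near_strip tt).
pose m := Num.min r1 (Num.min r2 r3).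
have m0 : 0 < m by rewrite !lt_min r10 r20 r30.
have [mr1 mr2 mr3] : [/\ m <= r1, m <= r2 & m <= r3].
  by split; rewrite /m !ge_min lexx ?orbT.
pose h := m / 2.
have hm : 0 < h < m by rewrite /h; lra.
have strip s : t <= s <= t + h -> t0 < s < t1.
  move=> hs; apply: h3; rewrite /ball /= distrC ger0_norm; lra.
have isd (F : R -> R) z : derivable F z 1 -> is_derive z 1 F (derive1 F z).
  by move=> dF; rewrite derive1E; exact/derivableP.
have th : t < t + h by rewrite ltrDl; case/andP: hm.
have xh : x < x + h by rewrite ltrDl; case/andP: hm.
have [|xi hxi E1] := @mvt_seg (fun s => f s (x + h) - f s x)
  (fun s => derive1 (f^~ (x + h)) s - derive1 (f^~ x) s) t (t + h) th.
  move=> s /strip hs; apply: is_deriveB; apply: isd.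
    exact: (d1 (s, x + h) hs).1.
  exact: (d1 (s, x) hs).1.
have [|eta heta E2] := @mvt_seg (fun y => derive1 (f^~ y) xi) (ftx xi) x (x + h) xh.
  by move=> y _; apply: isd; exact: (d2 (xi, y) (strip _ hxi)).2.
have thD : t0 < t + h < t1 by apply: strip; rewrite lexx ltW.
have [|eta' heta' E3] := @mvt_seg (fun y => f (t + h) y - f t y)
  (fun y => derive1 (f (t + h)) y - derive1 (f t) y) x (x + h) xh.
  move=> y _; apply: is_deriveB; apply: isd.
    exact: (d1 (t + h, y) thD).2.
  exact: (d1 (t, y) tt).2.
have [|xi' hxi' E4] := @mvt_seg (fun s =>
  derive1 (f s) eta') (fxt^~ eta') t (t + h) th.
  by move=> s hs; apply: isd; exact: (d3 (s, eta') (strip _ hs)).1.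
have E : ftx xi eta = fxt xi' eta'.
  have hh : (t + h - t) * (x + h - x) != 0.
    have -> : t + h - t = h by ring.
    have -> : x + h - x = h by ring.
    by rewrite mulf_neq0 // gt_eqF //; case/andP: hm.
  apply: (mulIf hh).
  transitivity (f (t + h) (x + h) - f (t + h) x - (f t (x + h) - f t x)).
    by rewrite E1 E2 -mulrA [X in _ * X = _]mulrC.
  transitivity (f (t + h) (x + h) - f t (x + h) - (f (t + h) x - f t x)).
    by ring.
  by rewrite E3 E4 -mulrA.
have close (z w : R) : z <= w <= z + h -> `|w - z| < m.
  by move=> zw; apply: dist_lt_itv zw; case/andP: hm.
have hA : `|ftx xi eta - A| < e.
  exact: (h1 xi eta (lt_le_trans (close _ _ hxi) mr1) (lt_le_trans (close _ _
    heta) mr1)).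
have hB : `|fxt xi' eta' - B| < e.
  exact: (h2 xi' eta' (lt_le_trans (close _ _ hxi') mr2) (lt_le_trans (close _ _
    heta') mr2)).
rewrite E distrC in hA.
have := le_lt_trans (ler_distD (fxt xi' eta') A B) (ltrD hA hB).
by rewrite /e -splitr ltxx.
Qed.

Lemma Cn_on_component m n (f : R -> R -> 'rV[R]_m) k :
  Cn_on n D f -> Cn_on n D (fun t x => f t x 0 k).
Proof.
elim: n f => [|n IH] f [cf df].
  split=> // p Dp; exact: (cvg_comp _ _ (cf p Dp) (@coord_continuous _ _ _ 0 k _)).
have [d1 c1 c2] := df; split.
  by move=> p Dp; exact: (cvg_comp _ _ (cf p Dp) (@coord_continuous _ _ _ 0 k _)).
split.
- move=> p Dp; have [a b] := d1 p Dp.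
  by split; [have [] := derive1_component k a|have [] := derive1_component k b].
- apply: Cn_on_ext (IH _ c1) => t x tt.
  symmetry; exact: (@derive1_component R m (fun s => f s x) t k (d1 (t, x) tt).1).2.
- apply: Cn_on_ext (IH _ c2) => t x tt.
  symmetry; exact: (@derive1_component R m (f t) x k (d1 (t, x) tt).2).2.
Qed.

Lemma smooth_on_dx (f : R -> R -> R) : smooth_on D f ->
  smooth_on D (fun t x => derive1 (f t) x).
Proof. by move=> sf n; have [_ []] := sf n.+1. Qed.

(** Induction on j through the x-derivative of f, again smooth on the strip; each step exchanges one
    pair of mixed derivatives. *)
Lemma derive1n_partial_comm (f : R -> R -> R) j t x : t0 < t < t1 ->
  smooth_on D f ->
  derivable (fun s => derive1n j (f s) x) t 1 /\
  derive1 (fun s => derive1n j (f s) x) t =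
    derive1n j (fun y => derive1 (f^~ y) t) x.
Proof.
move=> tt; elim: j f => [|j IH] f sf.
  have [_ [d1 _ _]] := sf 1%N; split; first exact: (d1 (t, x) tt).1.
  by [].
have [h1 h2] := IH _ (smooth_on_dx sf).
under eq_fun do rewrite derive1Sn.
split; first exact: h1.
apply: etrans h2 _; rewrite derive1Sn.
suff -> : (fun y => derive1 (fun s => derive1 (f s) y) t) = derive1 (fun y =>
  derive1 (f^~ y) t) by [].
by apply/funext => y; rewrite -(partial_derive_comm y tt (sf 2%N)).
Qed.

End Strip.

(** * The Lax equation *)

Section Jets.
Context {R : realType} (n : nat) (x : R).
Implicit Types (P Q : (R -> R) -> R).

(** A differential operator of order less than n, seen through its values at x. It bounds the order
    of the commutator without writing down the coefficients. *)
Definition jet P := exists c : nat -> R, forall f, smooth f ->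
  P f = \sum_(j < n) c j * derive1n j f x.

Lemma jetD P Q : jet P -> jet Q -> jet (fun f => P f + Q f).
Proof.
move=> [c hc] [d hd]; exists (fun j => c j + d j) => f sf.
by rewrite hc // hd // -big_split /=; apply: eq_bigr => j _; rewrite mulrDl.
Qed.

Lemma jetZ (a : R) P : jet P -> jet (fun f => a * P f).
Proof.
move=> [c hc]; exists (fun j => a * c j) => f sf.
by rewrite hc // mulr_sumr; apply: eq_bigr => j _; rewrite mulrA.
Qed.

Lemma jetB P Q : jet P -> jet Q -> jet (fun f => P f - Q f).
Proof.
move=> hP hQ; have [c hc] := jetD hP (jetZ (-1) hQ); exists c => f sf.
by rewrite -hc // mulN1r.
Qed.

Lemma jet_derive1n j : (j < n)%N -> jet (derive1n j ^~ x).
Proof.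
move=> jn; exists (fun i => (i == j)%:R) => f _.
rewrite (bigD1 (Ordinal jn)) //= eqxx mul1r big1 ?addr0 // => i.
by rewrite -val_eqE /= => /negbTE ->; rewrite mul0r.
Qed.

Lemma jet_sum (I : Type) (r : seq I) (F : I -> (R -> R) -> R) :
  (forall i, jet (F i)) -> jet (fun f => \sum_(i <- r) F i f).
Proof.
move=> hF; elim: r => [|i r [c hc]].
  exists (fun=> 0) => f _; rewrite big_nil big1 // => j _; exact: mul0r.
have [e he] := jetD (hF i) (ex_intro _ c hc); exists e => f sf.
by rewrite big_cons -he.
Qed.

End Jets.

Section Commutator.
Context {R : realType} (d : nat) (u : nat -> R -> R) (q : R -> R).
Hypothesis su : forall i, (i < d)%N -> smooth (u i).
Hypothesis sq : smooth q.

Definition Lact (f : R -> R) x :=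
  derive1n d.+1 f x + \sum_(i < d) u i x * derive1n i f x.

Definition Qact (f : R -> R) x := derive1n 2 f x + q x * f x.

Lemma derive1n_Lact f x : smooth f ->
  derive1n 2 (Lact f) x = derive1n d.+3 f x +
  \sum_(i < d) (derive1n 2 (u i) x * derive1n i f x +
    2 * (derive1n 1 (u i) x * derive1n i.+1 f x) + u i x * derive1n i.+2 f x).
Proof.
move=> sf; have sfi i : smooth (derive1n i f) := @smooth_derive1n _ i _ sf.
have sF (i : 'I_d) : smooth (fun x => u i x * derive1n i f x).
  exact: (smoothM (su (ltn_ord i)) (sfi i)).
have := derive1nD 2 (sfi d.+1) (@smooth_sum _ _ (index_enum _) _ sF).
move=> /(congr1 (fun h => h x)) E; apply: etrans E _; congr (_ + _).
have := @derive1n_sum _ 2 _ (index_enum _) _ sF.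
move=> /(congr1 (fun h => h x)) E; apply: etrans E _; apply: eq_bigr => i _.
rewrite (derive1nM 2 (su (ltn_ord i)) (sfi i)).
rewrite !(big_ord_recl, big_ord0) /= addr0 /bump /= !addn0 !add1n !mul1r addrA.
by [].
Qed.

Lemma derive1n_Qact n f x : smooth f ->
  derive1n n (Qact f) x = derive1n n.+2 f x +
  \sum_(j < n.+1) 'C(n, j)%:R * (derive1n (n - j) q x * derive1n j f x).
Proof.
move=> sf; have := derive1nD n (@smooth_derive1n _ 2 _ sf) (smoothM sq sf).
move=> /(congr1 (fun h => h x)) E; apply: etrans E _; congr (_ + _).
  by rewrite /derive1n -iterD addn2.
by rewrite (derive1nM n sq sf).
Qed.

(* The terms of order d + 3 and d + 1 cancel and there is none of order d + 2,
   since L has no term of order d. *)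
Lemma jet_commutator x : jet d.+1 x (fun f => Qact (Lact f) x - Lact (Qact f) x).
Proof.
(* What remains of the commutator once f^(d+3), q f^(d+1) and all u_i f^(i+2) have cancelled between
   the two products; nothing here exceeds order d. *)
have : jet d.+1 x (fun f =>
  \sum_(i < d) (derive1n 2 (u i) x * derive1n i f x +
    2 * (derive1n 1 (u i) x * derive1n i.+1 f x)) +
  q x * (\sum_(i < d) u i x * derive1n i f x) -
  (\sum_(j < d.+1) 'C(d.+1, j)%:R * (derive1n (d.+1 - j) q x * derive1n j f x) +
   \sum_(i < d) u i x *
     \sum_(j < i.+1) 'C(i, j)%:R * (derive1n (i - j) q x * derive1n j f x))).
  apply: jetB; apply: jetD.
  - apply: jet_sum => i; have id := ltn_ord i; apply: jetD.
      by apply: jetZ; apply: jet_derive1n; lia.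
    by do 2 apply: jetZ; apply: jet_derive1n; lia.
  - apply: jetZ; apply: jet_sum => i; have id := ltn_ord i.
    by apply: jetZ; apply: jet_derive1n; lia.
  - by apply: jet_sum => j; do 2 apply: jetZ; apply: jet_derive1n; exact: ltn_ord.
  - apply: jet_sum => i; have id := ltn_ord i; apply: jetZ.
    apply: jet_sum => j; have ji := ltn_ord j.
    by do 2 apply: jetZ; apply: jet_derive1n; lia.
move=> [c hc]; exists c => f sf; rewrite -hc //.
have S : \sum_(i < d) u i x * derive1n i (Qact f) x =
  \sum_(i < d) u i x * derive1n i.+2 f x +
  \sum_(i < d) u i x *
     \sum_(j < i.+1) 'C(i, j)%:R * (derive1n (i - j) q x * derive1n j f x).
  by rewrite -big_split /=; apply: eq_bigr => i _; rewrite derive1n_Qact // mulrDr.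
have E1 : Qact (Lact f) x = derive1n 2 (Lact f) x + q x * Lact f x by [].
have E2 : Lact (Qact f) x = derive1n d.+1 (Qact f) x +
  \sum_(i < d) u i x * derive1n i (Qact f) x by [].
rewrite E1 E2 S derive1n_Lact // derive1n_Qact // /Lact.
rewrite [in LHS]big_ord_recr /= binn subnn mul1r derive1n0 [in LHS]big_split /=.
ring.
Qed.

End Commutator.

Section Flow.
Context {R : realType} (d : nat) (t0 t1 a : R).
Variables (g : 'I_d.+1 -> R -> R -> R) (u : R -> nat -> R -> R).
Hypothesis d0 : (0 < d)%N.
Hypothesis g_on : forall k, smooth_on [set p | t0 < p.1 < t1] (g k).
Hypothesis sg : forall t k, t0 < t < t1 -> smooth (g k t).
Hypothesis su : forall t i, t0 < t < t1 -> (i < d)%N -> smooth (u t i).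
Hypothesis det_g : forall t x, t0 < t < t1 -> \det (wronskian_mx (fun k =>
  g k t) x) = 1.
Hypothesis g_eq : forall t k x, t0 < t < t1 ->
  derive1n d.+1 (g k t) x = - \sum_(i < d) u t i x * derive1n i (g k t) x.

Let q t (x : R) := 2 / d.+1%:R * u t d.-1 x.

Hypothesis g_flow : forall t k x, t0 < t < t1 ->
  derive1 (g k ^~ x) t = a * Qact (q t) (g k t) x.

(** Regularity of u in t comes from that of Gamma: the companion matrix is the Wronskian matrix of
    Gamma' times the inverse of that of Gamma, so its last row makes u_i a polynomial in
    x-derivatives of the components of Gamma, which are derivable in t. *)
Lemma coefficient_derivable t i x : t0 < t < t1 -> (i < d)%N ->
  derivable (fun s => u s i x) t 1.
Proof.
move=> tt id; pose i' : 'I_d.+1 := widen_ord (leqnSn d) (Ordinal id).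
have E s : t0 < s < t1 -> - (\sum_k derive1n d.+1 (g k s) x *
    \adj (wronskian_mx (fun k => g k s) x) k i') = u s i x.
  move=> ss; have := frame_mx1 (fun y => det_g y ss) (fun k y => g_eq k y ss) x.
  move=> /matrixP/(_ ord_max i'); rewrite mxE [RHS]mxE eqxx /= id => F.
  rewrite -[RHS]opprK -F; congr (- _); apply: eq_bigr => k _; congr (_ * _).
  by rewrite mxE /= derive1n1 -derive1Sn.
apply: near_eq_derivable (_ : derivable (fun s =>
  - (\sum_k derive1n d.+1 (g k s) x *
    \adj (wronskian_mx (fun k => g k s) x) k i')) t 1).
  by apply: filterS (near_strip tt) => s; exact: E.
have dg j k : derivable (fun s => derive1n j (g k s) x) t 1.
  by have [] := derive1n_partial_comm j x tt (g_on k).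
pose P (f : R -> R) := derivable f t 1.
have Pc c : P (fun=> c) by exact: derivable_cst.
have PD f h : P f -> P h -> P (fun s => f s + h s) by exact: derivableD.
have PM f h : P f -> P h -> P (fun s => f s * h s) by exact: derivableM.
apply: derivableN; apply: (closed_sum Pc PD) => k _; apply: (PM _ _ (dg _ _)).
apply: (closed_adj Pc PD PM) => k' j; rewrite /P.
by under eq_fun do rewrite mxE; exact: dg.
Qed.

Lemma is_derive_coefficient t i x : t0 < t < t1 -> (i < d)%N ->
  is_derive t 1 (fun s => u s i x) (derive1 (fun s => u s i x) t).
Proof. by move=> tt id; rewrite derive1E;
  apply/derivableP/coefficient_derivable. Qed.

Lemma smooth_potential t : t0 < t < t1 -> smooth (q t).
Proof.
move=> tt; have dd : (d.-1 < d)%N by rewrite prednK.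
exact: (@smoothZ _ _ _ (su tt dd)).
Qed.

Lemma smooth_Qact t k : t0 < t < t1 -> smooth (Qact (q t) (g k t)).
Proof.
move=> tt; have sgk := @sg t k tt.
exact: (smoothD (@smooth_derive1n _ 2 _ sgk) (smoothM (smooth_potential tt) sgk)).
Qed.

Lemma flow_component t k x : t0 < t < t1 ->
  \sum_(i < d) derive1 (fun s => u s i x) t * derive1n i (g k t) x =
  - (a * Lact d (u t) (Qact (q t) (g k t)) x).
Proof.
move=> tt.
have dg j : is_derive t 1 (fun s => derive1n j (g k s) x)
    (a * derive1n j (Qact (q t) (g k t)) x).
  have [h1 h2] := derive1n_partial_comm j x tt (g_on k).
  have -> : a * derive1n j (Qact (q t) (g k t)) x = derive1 (fun s =>
    derive1n j (g k s) x) t.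
    rewrite h2 (_ : (fun y => derive1 (g k ^~ y) t) = fun y =>
      a * Qact (q t) (g k t) y).
      by rewrite derive1nZ //; exact: smooth_Qact.
    by apply/funext => y; rewrite g_flow.
  by rewrite derive1E; exact/derivableP.
pose F s := derive1n d.+1 (g k s) x + \sum_(i < d) u s i x * derive1n i (g k s) x.
have F0 : derive1 F t = 0.
  rewrite derive1E (near_eq_derive _ (_ : \near t, F t = cst 0 t)) ?derive_cst //.
  by apply: filterS (near_strip tt) => s ss; rewrite /F g_eq // addNr.
have F1 : is_derive t 1 F (a * derive1n d.+1 (Qact (q t) (g k t)) x +
  \sum_(i < d) (u t i x * (a * derive1n i (Qact (q t) (g k t)) x) +
     derive1n i (g k t) x * derive1 (fun s => u s i x) t)).
  apply: is_deriveD.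
  rewrite (_ : (fun s => _) = \sum_(i < d) (fun s =>
    u s i x * derive1n i (g k s) x)); last first.
    by apply/funext => s; rewrite fct_sumE.
  apply: is_derive_sum => i; apply: is_deriveM.
  exact: is_derive_coefficient.
have := derive1_val F1; rewrite F0 big_split /= => /esym E.
rewrite /Lact mulrDr mulr_sumr.
have -> : \sum_(i < d) derive1 (fun s => u s i x) t * derive1n i (g k t) x =
  \sum_(i < d) derive1n i (g k t) x * derive1 (fun s => u s i x) t.
  by apply: eq_bigr => i _; rewrite mulrC.
have -> : \sum_(i < d) a * (u t i x * derive1n i (Qact (q t) (g k t)) x) =
  \sum_(i < d) u t i x * (a * derive1n i (Qact (q t) (g k t)) x).
  by apply: eq_bigr => i _; rewrite mulrCA.
by apply/eqP; rewrite -addr_eq0 addrC -addrA E.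
Qed.

Theorem flow_lax t f x : t0 < t < t1 -> smooth f ->
  \sum_(i < d) derive1 (fun s => u s i x) t * derive1n i f x =
  a * (Qact (q t) (Lact d (u t) f) x - Lact d (u t) (Qact (q t) f) x).
Proof.
move=> tt sf.
have sq := smooth_potential tt.
have [c hc] := @jet_commutator R d (u t) (q t) (fun i => su tt) sq x.
(* Padding by 0 at index d makes both operators act on the same d + 1 derivatives; the comparison
   then includes a c_d = 0. *)
pose ut (j : nat) := if (j < d)%N then derive1 (fun s => u s j x) t else 0.
have sumE h : \sum_(i < d) derive1 (fun s => u s i x) t * derive1n i h x =
   \sum_(j < d.+1) ut j * derive1n j h x.
  rewrite big_ord_recr /= {2}/ut ltnn mul0r addr0; apply: eq_bigr => j _.
  by rewrite /ut ltn_ord.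
suff H (j : 'I_d.+1) : ut j = a * c j.
  rewrite hc // sumE mulr_sumr; apply: eq_bigr => j _.
  by rewrite H mulrA.
have L0 k : Lact d (u t) (g k t) = fun=> 0.
  by apply/funext => y; rewrite /Lact g_eq // addNr.
pose w : 'rV[R]_d.+1 := \row_j (ut j - a * c j).
have w0 : w *m wronskian_mx (fun k => g k t) x = 0.
  apply/rowP => k; rewrite !mxE.
  have := flow_component k x tt; rewrite sumE => E.
  have := hc _ (@sg t k tt).
  rewrite L0 {1}/Qact derive1n_cst mulr0 addr0 sub0r => E'.
  have : \sum_(j < d.+1) ut j * derive1n j (g k t) x -
      a * \sum_(j < d.+1) c j * derive1n j (g k t) x = 0 by rewrite E -E' mulrN
        subrr.
  rewrite mulr_sumr -sumrB => Z; apply: etrans Z; apply: eq_bigr => m _.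
  by rewrite !mxE mulrBl mulrA.
have : w = 0.
  by rewrite -[w]mulmx1 -(mul_wronskian_mx_adj (fun y =>
    det_g y tt) x) mulmxA w0 mul0mx.
by move=> /rowP/(_ j); rewrite !mxE => /eqP; rewrite subr_eq0 => /eqP.
Qed.

End Flow.

(** * The centralized case and the rescaling of time *)

Section Centralized.
Context {R : realType} {d : nat} {chi : config R d}.
Hypothesis hd : (2 <= d)%N.
Hypothesis hchi : nondegenerate_config chi.
Hypothesis hc : centralized chi.

(** [centralized] is applied to the expansion already found for this very setting: its coefficient
    of order 1 is the constant alpha_11, which must vanish. *)
Lemma centralized_expansion gamma Gamma u Geps G1 G2 :
  pentagram_setting chi gamma Gamma u Geps -> expansion Gamma Geps G1 G2 ->
  G2 = cst (alpha22 chi) *: Q2op d u.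
Proof.
move=> S hG; have hE := setting_expansion hd S hchi.
have /(congr1 (fun P : diffop R => (P`_1 : R -> R) 0)) := hc S hE.
rewrite coefZ coefX mulr1 coef0 => a11.
have {}a11 : alpha11 chi = 0 := a11.
have [_ ->] := expansion_unique S hG hE.
rewrite a11 (_ : (fun _ => _) = 0) ?polyC0 ?subr0 //.
by apply/funext => x; rewrite expr0n !mul0r.
Qed.

Lemma centralized_neq0 gamma Gamma u Geps G1 G2 :
  pentagram_setting chi gamma Gamma u Geps -> expansion Gamma Geps G1 G2 ->
  G2 != 0 -> alpha22 chi != 0.
Proof.
move=> S hG; apply: contra => /eqP a22.
by rewrite (centralized_expansion S hG) a22 scale0r.
Qed.

Lemma continuous_limit_lax t0 t1 Gamma u : continuous_limit chi t0 t1 Gamma u ->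
  lax_equation d (alpha22 chi) [set t : R | t0 < t < t1] u
    (fun t => Q2op d (u t)).
Proof.
move=> [hs hl].
have d0 : (0 < d)%N by exact: ltnW.
pose g k t x : R := Gamma t x 0 k.
have g_on k : smooth_on [set p | t0 < p.1 < t1] (g k).
  by move=> n; exact: (Cn_on_component k (hs n)).
have sG t : t0 < t < t1 -> smooth (Gamma t).
  by move=> /hl[? [? [? [? [S _ _ _]]]]]; exact: (setting_smooth S).
have sg t k : t0 < t < t1 -> smooth (g k t).
  by move=> tt; exact: (@smooth_component _ _ _ k (sG t tt)).
have su t i : t0 < t < t1 -> (i < d)%N -> smooth (u t i).
  by move=> /hl[? [? [? [? [S _ _ _]]]]]; exact: (setting_smooth_u S).
have det_g t x : t0 < t < t1 -> \det (wronskian_mx (fun k => g k t) x) = 1.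
  by move=> /hl[? [? [? [? [S _ _ _]]]]]; exact: (setting_det S).
have g_eq t k x : t0 < t < t1 ->
    derive1n d.+1 (g k t) x = - \sum_(i < d) u t i x * derive1n i (g k t) x.
  by move=> /hl[? [? [? [? [S _ _ _]]]]]; exact: (setting_eq S).
have g_flow t k x : t0 < t < t1 -> derive1 (g k ^~ x) t =
    alpha22 chi * Qact (fun y => 2 / d.+1%:R * u t d.-1 y) (g k t) x.
  move=> tt; have [gamma [Geps [G1 [G2 [S hE _ /(_ x)]]]]] := hl t tt.
  rewrite (centralized_expansion S hE) => -[dfl vfl].
  rewrite (derive1_component k dfl).2 derive1E vfl.
  rewrite dact_component; last exact: sG.
  by rewrite dactZ dact_Q2op.
move=> t tt; split=> [i x id|f x sf].
  exact: (coefficient_derivable g_on det_g g_eq).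
rewrite (flow_lax d0 g_on sg su det_g g_eq g_flow x tt sf).
have LE h : dact (Lop d (u t)) h = Lact d (u t) h.
  by apply/funext => y; rewrite dact_Lop.
have QE h : dact (Q2op d (u t)) h = Qact (fun y => 2 / d.+1%:R * u t d.-1 y) h.
  by apply/funext => y; rewrite dact_Q2op.
by rewrite !LE !QE.
Qed.

End Centralized.

(** The new time is s = c t, so u is read at s / c and the chain rule contributes the factor 1/c. *)
Lemma lax_equation_rescale (R : realType) (d : nat) (c : R) (T : set R)
    (u : R -> nat -> R -> R) (Q : R -> diffop R) : c != 0 ->
  lax_equation d c T u Q ->
  lax_equation d 1 [set s | T (s / c)] (fun s => u (s / c)) (fun s => Q (s / c)).
Proof.
move=> c0 h s Ts; have [hu hL] := h _ Ts.
have du i x : (i < d)%N -> is_derive s 1 (fun r => u (r / c) i x)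
    (derive1 (fun r => u r i x) (s / c) * c^-1).
  move=> id; have dc : is_derive s 1 (fun r : R => r / c) c^-1.
    rewrite (_ : (fun r => r / c) = fun r => c^-1 * r).
      by rewrite -[X in is_derive _ _ _ X]mulr1; apply: is_deriveZ.
    by apply/funext => r; rewrite mulrC.
  have du : is_derive (s / c) 1 (fun r => u r i x) (derive1 (fun r =>
    u r i x) (s / c)).
    by rewrite derive1E; apply/derivableP; exact: hu.
  exact: (@realfun.is_derive1_comp R (fun r => u r i x) (fun r =>
    r / c) s _ _ du dc).
split=> [i x id|f x sf]; first by have [] := du i x id.
rewrite mul1r -[RHS](mulKf c0) -hL // mulr_sumr; apply: eq_bigr => i _.
by rewrite (derive1_val (du i x (ltn_ord i))); ring.
Qed.

Theorem theorem3 (R : realType) (d : nat) (hd : (2 <= d)%N)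
    (chi : config R d) (hchi : nondegenerate_config chi) :
  exists a11 a22 : R,
    (forall (gamma : R -> RP R d) (Gamma : R -> 'rV[R]_d.+1)
            (u : nat -> R -> R) (Geps : R -> R -> 'rV[R]_d.+1)
            (G1 G2 : diffop R),
       pentagram_setting chi gamma Gamma u Geps ->
       (expansion Gamma Geps G1 G2 <->
        G1 = cst a11 *: 'X /\
        G2 = cst a22 *: Q2op d u -
             (fun x => a11 ^+ 2 / d.+1%:R * u d.-1 x)%:P)) /\
    (centralized chi ->
       (forall (gamma : R -> RP R d) (Gamma : R -> 'rV[R]_d.+1)
               (u : nat -> R -> R) (Geps : R -> R -> 'rV[R]_d.+1)
               (G1 G2 : diffop R),
          pentagram_setting chi gamma Gamma u Geps ->
          expansion Gamma Geps G1 G2 ->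
          G2 != 0 ->
          [/\ a22 != 0,
              G2 = cst a22 *: Q2op d u &
              forall K : psido, psi_root d.+1 (Lop d u) K ->
                kdvQ 2 K = Q2op d u]) /\
       (forall (t0 t1 : R) (Gamma : R -> R -> 'rV[R]_d.+1)
               (u : R -> nat -> R -> R),
          t0 < t1 ->
          continuous_limit chi t0 t1 Gamma u ->
          [/\ a22 != 0,
              lax_equation d a22 [set t : R | t0 < t < t1] u
                (fun t => Q2op d (u t)) &
              lax_equation d 1 [set s : R | t0 < s / a22 < t1]
                (fun s => u (s / a22)) (fun s => Q2op d (u (s / a22)))])).
Proof.
exists (alpha11 chi), (alpha22 chi); split=> [gamma Gamma u Geps G1 G2 S|hc].
  have hE := setting_expansion hd S hchi.
  by split=> [hG|[-> ->]]; [exact: (expansion_unique S hG hE)|].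
split=> [gamma Gamma u Geps G1 G2 S hG G0|t0 t1 Gamma u t01 hl].
  split; first exact: (centralized_neq0 hd hchi hc S hG G0).
    exact: (centralized_expansion hd hchi hc S hG).
  by move=> K; exact: kdvQ2_root.
(* The time interval is nonempty, and its midpoint provides a setting with G2 nonzero. *)
have a0 : alpha22 chi != 0.
  have [_ /(_ ((t0 + t1) / 2))[]] := hl; first by apply/andP; split; lra.
  move=> gamma [Geps [G1 [G2 [S hG G0 _]]]].
  exact: (centralized_neq0 hd hchi hc S hG G0).
have L := continuous_limit_lax hd hchi hc hl.
by split=> //; exact: lax_equation_rescale L.
Qed.
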